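(* There is a Martin-Löf random set $Z$ such that for every recursive set $R$, $\Omega\leq_T Z\cap R$ or $\Omega\leq_T Z\setminus R$.
   Context: $\Omega$ is Chaitin's halting probability, viewed as the set of positions of $1$s in its binary expansion. *)

(* Defs.v *)
From HB Require Import structures.
From Stdlib Require Cantor.
From mathcomp Require Import all_boot all_order all_algebra.
From mathcomp Require Import all_classical all_reals all_analysis.

Set Implicit Arguments.
Unset Strict Implicit.
Unset Printing Implicit Defensive.

Import Order.TTheory GRing.Theory Num.Theory.

Local Open Scope classical_set_scope.
Local Open Scope ring_scope.

Definition npair (a b : nat) : nat := Cantor.to_nat (a, b).

(* Programs for the unary partial functions that are partial recursive in an
   oracle; functions of several arguments act on iterated Cantor pairs. *)
Inductive prog : Type :=
| Zero | Succ | Fst | Snd | Oracle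
| Pair of prog & prog
| Comp of prog & prog
| Prec of prog & prog
| Mu of prog.

(* [runs_to A p x y]: with oracle A, p halts on input x with output y. *)
Inductive runs_to (A : set nat) : prog -> nat -> nat -> Prop :=
| runs_zero x : runs_to A Zero x 0%N
| runs_succ x : runs_to A Succ x x.+1
| runs_fst x y : runs_to A Fst (npair x y) x
| runs_snd x y : runs_to A Snd (npair x y) y
| runs_oracle x : runs_to A Oracle x (x \in A)
| runs_pair p q x y z :
    runs_to A p x y -> runs_to A q x z -> runs_to A (Pair p q) x (npair y z)
| runs_comp p q x y z :
    runs_to A q x y -> runs_to A p y z -> runs_to A (Comp p q) x z
| runs_prec0 p q x y :
    runs_to A p x y -> runs_to A (Prec p q) (npair x 0%N) y
| runs_precS p q x n y z :
    runs_to A (Prec p q) (npair x n) y ->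
    runs_to A q (npair x (npair n y)) z ->
    runs_to A (Prec p q) (npair x n.+1) z
| runs_mu p x n (v : nat -> nat) :
    (forall i, (i < n)%N -> runs_to A p (npair x i) (v i).+1) ->
    runs_to A p (npair x n) 0%N ->
    runs_to A (Mu p) x n.

(* The empty oracle always answers 0, so [runs_to set0] is oracle-free
   computation: it yields exactly the partial recursive functions. *)
Definition computes (p : prog) : nat -> nat -> Prop := runs_to set0 p.

Definition recursive (X : set nat) : Prop :=
  exists p, forall n, computes p n (n \in X).

Definition turing_le (X A : set nat) : Prop :=
  exists p, forall n, runs_to A p n (n \in X).

(* Bijective base-2 numeration, a bijection from binary strings onto nat. *)
Fixpoint string_code (s : bitseq) : nat :=
  if s is b :: s' then ((string_code s').*2 + b.+1)%N else 0%N.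

Definition uniformly_ce (V : nat -> set bitseq) : Prop :=
  exists p, forall n s,
    V n s <-> exists y, computes p (npair n (string_code s)) y.

(* The positions of the 1s in the binary expansion of x in [0, 1[; position n
   has weight 2^-(n+1), and a dyadic rational gets its terminating expansion. *)
Definition binary_expansion (R : realType) (x : R) : set nat :=
  [set n | odd (Num.truncn (x * 2 ^+ n.+1))].

(* Uniform (fair-coin) measure on Cantor space: the image of Lebesgue measure on
   [0, 1[ under binary expansion. *)
Definition uniform_measure (R : realType) (C : set (set nat)) : \bar R :=
  lebesgue_measure (`[0, 1[ `&` (@binary_expansion R) @^-1` C).

Definition initial_segment (X : set nat) (k : nat) : bitseq :=
  mkseq (fun i => i \in X) k.

Definition open_of (W : set bitseq) : set (set nat) :=
  [set X | exists k, W (initial_segment X k)].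

Definition martin_lof_test (R : realType) (V : nat -> set bitseq) : Prop :=
  uniformly_ce V /\
  forall n, (uniform_measure R (open_of (V n)) <= (2 ^- n)%:E)%E.

Definition martin_lof_random (R : realType) (Z : set nat) : Prop :=
  forall V, martin_lof_test R V -> ~ (\bigcap_n open_of (V n)) Z.

(* The program p regarded as a machine from strings to strings. *)
Definition machine (p : prog) (s t : bitseq) : Prop :=
  computes p (string_code s) (string_code t).

Definition machine_domain (p : prog) : set bitseq :=
  [set s | exists t, machine p s t].

Definition prefix_free_machine (p : prog) : Prop :=
  forall s t, machine_domain p s -> machine_domain p t -> prefix s t -> s = t.

(* Universal in the sense of optimal: U simulates every prefix-free machine up to
   an additive constant in program length. *)
Definition universal_prefix_free_machine (U : prog) : Prop :=
  prefix_free_machine U /\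
  forall M, prefix_free_machine M -> exists d, forall s t, machine M s t ->
    exists2 s', machine U s' t & (size s' <= size s + d)%N.

Definition halting_probability (R : realType) (U : prog) : R :=
  fine (\esum_(s in machine_domain U) (2 ^- size s)%:E).

Definition Omega (R : realType) (U : prog) : set nat :=
  binary_expansion (halting_probability R U).

(* Main.v *)
Require Import Defs.
From Stdlib Require Cantor.
From mathcomp Require Import all_boot all_order all_algebra.
From mathcomp Require Import all_classical all_reals all_analysis.
From mathcomp Require Import zify.

(** The argument works for an arbitrary set X in place of Omega.  Build a set of
    coding positions, the union of finite blocks W_0, W_1, ..., that is cohesive
    for recursive sets: each recursive R contains, or is disjoint from, all but
    finitely many blocks.  The m-th block carries one bit b_m, coded as in the
    Kucera-Gacs theorem: the class of admissible sets is a Pi^0_1 class P_m, and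
    the bits of Z on W_m form the leftmost or the rightmost assignment that
    keeps the relative volume of P_m above a fixed threshold.  Whoever knows the
    earlier history and reads Z on W_m recovers b_m, because all assignments to
    its left, or all those to its right, are eventually seen to fall below the
    threshold; no bit of Z off the coding positions is needed.

    The bits themselves tell the decoder how to continue: they announce which
    recursive sets the later blocks are contained in, and which components of
    Martin-Loef tests P_(m+1) avoids, besides the elements of X.  Hence X is
    computable from every set that agrees with Z on almost all blocks, such as
    one of Z n R and Z \ R.  A set Z in all the classes P_m exists by compactness. *)

Set Implicit Arguments.
Unset Strict Implicit.
Unset Printing Implicit Defensive.

Import Order.TTheory GRing.Theory Num.Theory.
Local Open Scope classical_set_scope.
Local Open Scope nat_scope.

(** * Closure properties of recursive functions *)

Definition nfst (x : nat) : nat := (Cantor.of_nat x).1.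
Definition nsnd (x : nat) : nat := (Cantor.of_nat x).2.

Lemma npairE x : npair (nfst x) (nsnd x) = x.
Proof. by rewrite /npair -surjective_pairing Cantor.cancel_to_of. Qed.

Lemma nfst_pair x y : nfst (npair x y) = x.
Proof. by rewrite /nfst /npair Cantor.cancel_of_to. Qed.

Lemma nsnd_pair x y : nsnd (npair x y) = y.
Proof. by rewrite /nsnd /npair Cantor.cancel_of_to. Qed.

Definition npairK := (nfst_pair, nsnd_pair).

Arguments npair : simpl never.
Arguments nfst : simpl never.
Arguments nsnd : simpl never.
(* Conversion would otherwise evaluate the pairing function in unary. *)
#[global] Opaque npair nfst nsnd.

Lemma npair_gt0 x y : 0 < x -> 0 < npair x y.
Proof.
move=> x0; rewrite lt0n; apply/eqP => h.
have := nfst_pair x y; rewrite h => h'.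
by move: x0; rewrite -h'.
Qed.

(** Bounded sums and quantifiers take functions on [nat] rather than on ordinals, so that the
    closure lemmas can treat bound and body as functions of one coded argument. *)
Definition bsum (n : nat) (F : nat -> nat) : nat := \sum_(i < n) F i.
Definition ball (n : nat) (P : pred nat) : bool := [forall i : 'I_n, P i].
Definition bex (n : nat) (P : pred nat) : bool := [exists i : 'I_n, P i].

Lemma ballP n (P : pred nat) : reflect (forall i, i < n -> P i) (ball n P).
Proof.
apply: (iffP forallP) => [h i hi|h i]; first exact: (h (Ordinal hi)).
exact: h.
Qed.

Lemma bexP n (P : pred nat) : reflect (exists2 i, i < n & P i) (bex n P).
Proof.
apply: (iffP existsP) => [[i hi]|[i hi h]]; first by exists i.
by exists (Ordinal hi).
Qed.

Section Recursive.
Variable A : set nat.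

Definition rec_in (f : nat -> nat) := exists p, forall x, runs_to A p x (f x).

Lemma rec_eq f g : f =1 g -> rec_in f -> rec_in g.
Proof. by move=> fg [p hp]; exists p => x; rewrite -fg. Qed.

Lemma rec_fst : rec_in nfst.
Proof. by exists Fst => x; rewrite -{1}(npairE x); exact: runs_fst. Qed.

Lemma rec_snd : rec_in nsnd.
Proof. by exists Snd => x; rewrite -{1}(npairE x); exact: runs_snd. Qed.

Lemma rec_pair f g : rec_in f -> rec_in g -> rec_in (fun x => npair (f x) (g x)).
Proof. by move=> [p hp] [q hq]; exists (Pair p q) => x; exact: runs_pair. Qed.

Lemma rec_comp f g : rec_in f -> rec_in g -> rec_in (fun x => f (g x)).
Proof.
by move=> [p hp] [q hq]; exists (Comp p q) => x; apply: runs_comp (hq x) (hp _).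
Qed.

Lemma rec_id : rec_in id.
Proof. by apply: rec_eq (rec_pair rec_fst rec_snd) => x; exact: npairE. Qed.

Lemma rec_fst1 f : rec_in f -> rec_in (fun x => nfst (f x)).
Proof. exact: rec_comp rec_fst. Qed.

Lemma rec_snd1 f : rec_in f -> rec_in (fun x => nsnd (f x)).
Proof. exact: rec_comp rec_snd. Qed.

Lemma rec_S f : rec_in f -> rec_in (fun x => (f x).+1).
Proof. by apply: rec_comp; exists Succ => x; exact: runs_succ. Qed.

Lemma rec_const n : rec_in (fun=> n).
Proof.
elim: n => [|n]; last exact: rec_S.
by exists Zero => x; exact: runs_zero.
Qed.

Lemma rec_oracle f : rec_in f -> rec_in (fun x => (f x \in A : nat)).
Proof.
by apply: (@rec_comp (fun x => (x \in A : nat))); exists Oracle => x; exact: runs_oracle.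
Qed.

Fixpoint prim (f : nat -> nat) (g : nat -> nat) (x n : nat) : nat :=
  if n is n'.+1 then g (npair x (npair n' (prim f g x n'))) else f x.

Lemma rec_prim f g a b : rec_in f -> rec_in g -> rec_in a -> rec_in b ->
  rec_in (fun x => prim f g (a x) (b x)).
Proof.
move=> [p hp] [q hq] ra rb.
have r : rec_in (fun z => prim f g (nfst z) (nsnd z)).
  exists (Prec p q) => z; rewrite -{1}(npairE z).
  elim: (nsnd z) => [|n ih] /=; first exact: runs_prec0.
  exact: runs_precS ih (hq _).
by apply: rec_eq (rec_comp r (rec_pair ra rb)) => x; rewrite !npairK.
Qed.

Lemma rec_sum n (F : nat -> nat -> nat) :
  rec_in n -> rec_in (fun z => F (nfst z) (nsnd z)) ->
  rec_in (fun x => bsum (n x) (F x)).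
Proof.
move=> rn rF.
pose g z := nsnd (nsnd z) + F (nfst z) (nfst (nsnd z)).
have radd : rec_in (fun z => nfst z + nsnd z).
  apply: (@rec_eq (fun z => prim id (fun w => (nsnd (nsnd w)).+1) (nfst z) (nsnd z))).
    by move=> z; elim: (nsnd z) => [|k ih] /=; rewrite ?addn0 // !npairK ih addnS.
  apply: rec_prim; [exact: rec_id| |exact: rec_fst|exact: rec_snd].
  by apply: rec_S; apply: rec_snd1; exact: rec_snd.
have rg : rec_in g.
  apply: (@rec_eq (fun z => nfst (npair (nsnd (nsnd z)) (F (nfst z) (nfst (nsnd z)))) +
     nsnd (npair (nsnd (nsnd z)) (F (nfst z) (nfst (nsnd z)))))).
    by move=> z; rewrite !npairK.
  apply: (rec_comp radd); apply: rec_pair; first exact: (rec_comp rec_snd rec_snd).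
  apply: (rec_eq (f := fun z => F (nfst (npair (nfst z) (nfst (nsnd z))))
     (nsnd (npair (nfst z) (nfst (nsnd z)))))) => [z|]; first by rewrite !npairK.
  apply: (rec_comp rF); apply: rec_pair; first exact: rec_fst.
  exact: (rec_comp rec_fst rec_snd).
apply: (rec_eq (f := fun x => prim (fun=> 0) g x (n x))); last first.
  by apply: rec_prim => //; [exact: rec_const|exact: rec_id].
move=> x; rewrite /bsum; elim: (n x) => [|k ih] /=; first by rewrite big_ord0.
by rewrite big_ord_recr /= /g !npairK ih.
Qed.

Lemma rec_add f g : rec_in f -> rec_in g -> rec_in (fun x => f x + g x).
Proof.
move=> rf rg.
apply: (rec_eq (f := fun x => prim f (fun w => (nsnd (nsnd w)).+1) x (g x))).
  by move=> x; elim: (g x) => [|k ih] /=; rewrite ?addn0 // !npairK ih addnS.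
apply: rec_prim => //; last exact: rec_id.
by apply: rec_S; apply: rec_snd1; exact: rec_snd.
Qed.

Lemma rec_mul f g : rec_in f -> rec_in g -> rec_in (fun x => f x * g x).
Proof.
move=> rf rg; apply: (rec_eq (f := fun x => bsum (g x) (fun=> f x))) => [x|].
  by rewrite /bsum sum_nat_const card_ord mulnC.
by apply: (@rec_sum g (fun x _ => f x)) => //; apply: rec_comp rec_fst.
Qed.

Lemma rec_exp2 f : rec_in f -> rec_in (fun x => 2 ^ f x).
Proof.
move=> rf; apply: (rec_eq (f := fun x => prim (fun=> 1)
   (fun w => nsnd (nsnd w) + nsnd (nsnd w)) x (f x))).
  by move=> x; elim: (f x) => [|k ih] //=; rewrite !npairK ih expnS mul2n addnn.
have r : rec_in (fun w => nsnd (nsnd w)) by apply: rec_snd1; exact: rec_snd.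
by apply: rec_prim => //; [exact: rec_const|exact: rec_add|exact: rec_id].
Qed.

Lemma rec_pred f : rec_in f -> rec_in (fun x => (f x).-1).
Proof.
move=> rf; apply: (rec_eq (f := fun x => prim (fun=> 0)
   (fun w => nfst (nsnd w)) x (f x))).
  by move=> x; case: (f x) => [|k] //=; rewrite !npairK.
apply: rec_prim => //; [exact: rec_const|by apply: rec_fst1; exact: rec_snd|exact: rec_id].
Qed.

Lemma rec_sub f g : rec_in f -> rec_in g -> rec_in (fun x => f x - g x).
Proof.
move=> rf rg; apply: (rec_eq (f := fun x => prim f (fun w => (nsnd (nsnd w)).-1) x (g x))).
  by move=> x; elim: (g x) => [|k ih] /=; rewrite ?subn0 // !npairK ih subnS.
apply: rec_prim => //; last exact: rec_id.
by apply: rec_pred; apply: rec_snd1; exact: rec_snd.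
Qed.

Lemma rec_neg (b : nat -> bool) : rec_in b -> rec_in (fun x => ~~ b x : nat).
Proof.
move=> rb; apply: (rec_eq (f := fun x => 1 - b x)) => [x|]; first by case: (b x).
exact: (rec_sub (rec_const 1) rb).
Qed.

Lemma rec_eq0 f : rec_in f -> rec_in (fun x => f x == 0 : nat).
Proof.
move=> rf; apply: (rec_eq (f := fun x => 1 - f x)) => [x|]; last exact: rec_sub (rec_const 1) rf.
by case: (f x).
Qed.

Lemma rec_and (b c : nat -> bool) : rec_in b -> rec_in c ->
  rec_in (fun x => b x && c x : nat).
Proof.
move=> rb rc; apply: (rec_eq (f := fun x => b x * c x)) => [x|]; last exact: rec_mul.
by rewrite mulnb.
Qed.

Lemma rec_or (b c : nat -> bool) : rec_in b -> rec_in c ->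
  rec_in (fun x => b x || c x : nat).
Proof.
move=> rb rc; apply: (rec_eq (f := fun x => ~~ (~~ b x && ~~ c x) : nat)) => [x|].
  by rewrite negb_and !negbK.
by apply: rec_neg; apply: rec_and; exact: rec_neg.
Qed.

Lemma rec_imply (b c : nat -> bool) : rec_in b -> rec_in c ->
  rec_in (fun x => b x ==> c x : nat).
Proof.
move=> rb rc; apply: (rec_eq (f := fun x => ~~ b x || c x : nat)) => [x|].
  by rewrite implybE.
by apply: rec_or => //; exact: rec_neg.
Qed.

Lemma rec_le f g : rec_in f -> rec_in g -> rec_in (fun x => f x <= g x : nat).
Proof. by move=> rf rg; apply: rec_eq0; exact: rec_sub. Qed.

Lemma rec_eqn f g : rec_in f -> rec_in g -> rec_in (fun x => f x == g x : nat).
Proof.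
move=> rf rg; apply: (rec_eq (f := fun x => (f x <= g x) && (g x <= f x) : nat)) => [x|].
  by rewrite -eqn_leq.
by apply: rec_and; exact: rec_le.
Qed.

Lemma rec_eqb (b c : nat -> bool) : rec_in b -> rec_in c ->
  rec_in (fun x => b x == c x : nat).
Proof.
move=> rb rc; apply: (rec_eq (f := fun x => (b x : nat) == c x :> nat)) => [x|].
  by case: (b x) (c x) => [] [].
exact: rec_eqn.
Qed.

Lemma rec_if (b : nat -> bool) f g : rec_in b -> rec_in f -> rec_in g ->
  rec_in (fun x => if b x then f x else g x).
Proof.
move=> rb rf rg; apply: (rec_eq (f := fun x => b x * f x + (~~ b x) * g x)) => [x|].
  by case: (b x); rewrite mul1n mul0n ?addn0.
by apply: rec_add; apply: rec_mul => //; exact: rec_neg.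
Qed.

Lemma rec_ifb (b f g : nat -> bool) : rec_in b -> rec_in f -> rec_in g ->
  rec_in (fun x => (if b x then f x else g x) : nat).
Proof.
move=> rb rf rg; apply: (rec_eq (f := fun x => if b x then f x : nat else g x)) => [x|].
  by case: (b x).
exact: rec_if.
Qed.

Lemma rec_forall n (P : nat -> nat -> bool) :
  rec_in n -> rec_in (fun z => P (nfst z) (nsnd z)) ->
  rec_in (fun x => ball (n x) (P x) : nat).
Proof.
move=> rn rP; apply: (rec_eq (f := fun x => bsum (n x) (fun i => ~~ P x i) == 0 : nat)) => [x|].
  congr (nat_of_bool _); rewrite /bsum sum_nat_eq0.
  by apply: eq_forallb => i /=; rewrite eqb0 negbK.
by apply: rec_eq0; apply: (@rec_sum n (fun x i => ~~ P x i)) => //; exact: rec_neg.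
Qed.

Lemma rec_exists n (P : nat -> nat -> bool) :
  rec_in n -> rec_in (fun z => P (nfst z) (nsnd z)) ->
  rec_in (fun x => bex (n x) (P x) : nat).
Proof.
move=> rn rP; apply: (rec_eq (f := fun x => ~~ ball (n x) (fun i => ~~ P x i) : nat)) => [x|].
  by rewrite /ball negb_forall; congr (nat_of_bool _); apply: eq_existsb => i /=; rewrite negbK.
by apply: rec_neg; apply: (@rec_forall n (fun x i => ~~ P x i)) => //; exact: rec_neg.
Qed.

Lemma rec_odd f : rec_in f -> rec_in (fun x => odd (f x) : nat).
Proof.
move=> rf; apply: (rec_eq (f := fun x => prim (fun=> 0) (fun w => 1 - nsnd (nsnd w)) x (f x))).
  by move=> x; elim: (f x) => [|k ih] //=; rewrite !npairK ih; case: (odd k).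
have r : rec_in (fun w => nsnd (nsnd w)) by apply: rec_snd1; exact: rec_snd.
apply: rec_prim => //; [exact: rec_const|exact: rec_sub (rec_const 1) r|exact: rec_id].
Qed.

(** The quotient is the number of [i < f x] with [i.+1 * 2 ^ g x <= f x]. *)
Lemma rec_div2exp f g : rec_in f -> rec_in g -> rec_in (fun x => f x %/ 2 ^ g x).
Proof.
move=> rf rg.
apply: (rec_eq (f := fun x => bsum (f x) (fun i => i.+1 * 2 ^ g x <= f x))) => [x|].
  rewrite /bsum (eq_bigr (fun i : 'I_(f x) => (i < f x %/ 2 ^ g x : nat))); last first.
    by move=> i _; rewrite leq_divRL // expn_gt0.
  have : f x %/ 2 ^ g x <= f x by exact: leq_div.
  move: (f x) (f x %/ 2 ^ g x) => n d; elim: n => [|n ih] hd.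
    by move: hd; rewrite leqn0 big_ord0 => /eqP->.
  rewrite big_ord_recr /=; move: hd; rewrite leq_eqVlt => /predU1P[->|].
    rewrite ltnSn (eq_bigr (fun=> 1)) => [|i _].
      by rewrite sum_nat_const card_ord muln1 addn1.
    by rewrite (ltn_trans (ltn_ord i)).
  by rewrite ltnS => hd; rewrite ih // ltnNge hd addn0.
apply: (@rec_sum f (fun x i => (i.+1 * 2 ^ g x <= f x : nat))) => //.
apply: rec_le; last exact: rec_comp rec_fst.
apply: rec_mul; first by apply: rec_S; exact: rec_snd.
by apply: rec_exp2; exact: rec_comp rec_fst.
Qed.

(* The values of [T] are only searched for along the actual run, so the two
   searches need to succeed there only. *)
Lemma rec_iter_search (T w t : nat -> nat) (c1 c2 : nat -> bool) (h : nat -> nat) :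
  rec_in c1 -> rec_in c2 -> rec_in h ->
  (forall m, c1 (npair (npair m (T m)) (w m)) /\
     forall i, i < w m -> ~~ c1 (npair (npair m (T m)) i)) ->
  (forall m, c2 (npair (npair (npair m (T m)) (w m)) (t m)) /\
     forall i, i < t m -> ~~ c2 (npair (npair (npair m (T m)) (w m)) i)) ->
  (forall m, T m.+1 = h (npair (npair (npair m (T m)) (w m)) (t m))) ->
  rec_in T.
Proof.
(* [Mu] searches for a zero, so it is run on the negated tests. *)
move=> /rec_neg[p1 h1] /rec_neg[p2 h2] [ph hh] hw ht hT.
have [pi hi] := rec_id.
have [p0 hp0] := rec_const (T 0).
have [ps hs] := rec_snd.
(* The step drops the dummy parameter of [Prec], finds [w m] by [Mu p1], then [t m] by [Mu p2], and
   applies [h]. *)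
pose q := Comp (Comp ph (Comp (Pair pi (Mu p2)) (Pair pi (Mu p1)))) ps.
have rq m : runs_to A q (npair 0 (npair m (T m))) (T m.+1).
  apply: (runs_comp (y := npair m (T m))).
    by have := hs (npair 0 (npair m (T m))); rewrite npairK.
  rewrite hT; apply: runs_comp (hh _).
  apply: (runs_comp (y := npair (npair m (T m)) (w m))).
    apply: runs_pair; first exact: hi.
    have [hw1 hw2] := hw m.
    apply: (runs_mu (v := fun=> 0)) => [i /hw2 hi'|].
      by have := h1 (npair (npair m (T m)) i); rewrite hi'.
    by have := h1 (npair (npair m (T m)) (w m)); rewrite hw1.
  apply: runs_pair; first exact: hi.
  have [ht1 ht2] := ht m.
  apply: (runs_mu (v := fun=> 0)) => [i /ht2 hi'|].
    by have := h2 (npair (npair (npair m (T m)) (w m)) i); rewrite hi'.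
  by have := h2 (npair (npair (npair m (T m)) (w m)) (t m)); rewrite ht1.
have [pz hz] := rec_const 0.
exists (Comp (Prec p0 q) (Pair pz pi)) => n.
apply: runs_comp; first by apply: runs_pair; [exact: hz|exact: hi].
elim: n => [|n ih]; first by apply: runs_prec0; exact: hp0.
exact: runs_precS ih (rq n).
Qed.

End Recursive.

(** * A universal machine *)

Fixpoint prog_code (p : prog) : nat :=
  match p with
  | Zero => npair 1 0
  | Succ => npair 2 0
  | Fst => npair 3 0
  | Snd => npair 4 0
  | Oracle => npair 5 0
  | Pair p q => npair 6 (npair (prog_code p) (prog_code q))
  | Comp p q => npair 7 (npair (prog_code p) (prog_code q))
  | Prec p q => npair 8 (npair (prog_code p) (prog_code q))
  | Mu p => npair 9 (prog_code p)
  end.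

(* A stack is 0 when empty and otherwise [npair frame stack], a frame being
   [npair tag data] with a positive tag; a state is [npair value stack].  The
   frames with tags 1 to 9 are codes of programs to be applied to the value, and
   those with tags 10 to 13 are continuations: 10 and 11 wait for the components
   of a pair, 12 for the previous value of a primitive recursion, 13 for the
   current test of an unbounded search. *)
Definition step (s : nat) : nat :=
  let v := nfst s in
  let K := nsnd (nsnd s) in
  let tag := nfst (nfst (nsnd s)) in
  let d := nsnd (nfst (nsnd s)) in
  if nsnd s == 0 then s
  else if tag == 1 then npair 0 K
  else if tag == 2 then npair v.+1 K
  else if tag == 3 then npair (nfst v) K
  else if tag == 4 then npair (nsnd v) K
  else if tag == 5 then npair 0 K
  else if tag == 6 then
    npair v (npair (nfst d) (npair (npair 10 (npair (nsnd d) v)) K))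
  else if tag == 7 then npair v (npair (nsnd d) (npair (nfst d) K))
  else if tag == 8 then
    if nsnd v == 0 then npair (nfst v) (npair (nfst d) K)
    else let v' := npair (nfst v) (nsnd v).-1 in
      npair v' (npair (npair 8 d) (npair (npair 12 (npair (nsnd d) v')) K))
  else if tag == 9 then
    npair (npair v 0) (npair d (npair (npair 13 (npair d (npair v 0))) K))
  else if tag == 10 then
    npair (nsnd d) (npair (nfst d) (npair (npair 11 v) K))
  else if tag == 11 then npair (npair d v) K
  else if tag == 12 then
    npair (npair (nfst (nsnd d)) (npair (nsnd (nsnd d)) v)) (npair (nfst d) K)
  else if v == 0 then npair (nsnd (nsnd d)) K
  else let w := npair (nfst (nsnd d)) (nsnd (nsnd d)).+1 in
    npair w (npair (nfst d) (npair (npair 13 (npair (nfst d) w)) K)).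

Definition halted (s : nat) : bool := nsnd s == 0.

(* 0 as long as the machine runs, and the successor of the result afterwards. *)
Definition result (t e x : nat) : nat :=
  let s := iter t step (npair x (npair e 0)) in
  if halted s then (nfst s).+1 else 0.

Lemma iterD_step n m s : iter (n + m) step s = iter m step (iter n step s).
Proof. by rewrite addnC iterD. Qed.

Lemma frame_neq0 tag d K : 0 < tag -> (npair (npair tag d) K == 0) = false.
Proof. by move=> h; apply: negbTE; rewrite -lt0n; do 2!apply: npair_gt0. Qed.

Lemma prog_code_gt0 p : 0 < prog_code p.
Proof. by case: p => *; apply: npair_gt0. Qed.

Section Steps.
Variables (v K d : nat).

Ltac one := by rewrite /step !npairK frame_neq0.

Lemma step_zero : step (npair v (npair (npair 1 d) K)) = npair 0 K.
Proof. one. Qed.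
Lemma step_succ : step (npair v (npair (npair 2 d) K)) = npair v.+1 K.
Proof. one. Qed.
Lemma step_fst : step (npair v (npair (npair 3 d) K)) = npair (nfst v) K.
Proof. one. Qed.
Lemma step_snd : step (npair v (npair (npair 4 d) K)) = npair (nsnd v) K.
Proof. one. Qed.
Lemma step_oracle : step (npair v (npair (npair 5 d) K)) = npair 0 K.
Proof. one. Qed.
Lemma step_pair p q : step (npair v (npair (npair 6 (npair p q)) K)) =
  npair v (npair p (npair (npair 10 (npair q v)) K)).
Proof. one. Qed.
Lemma step_comp p q : step (npair v (npair (npair 7 (npair p q)) K)) =
  npair v (npair q (npair p K)).
Proof. one. Qed.
Lemma step_prec0 p q x : step (npair (npair x 0) (npair (npair 8 (npair p q)) K)) =
  npair x (npair p K).
Proof. one. Qed.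
Lemma step_precS p q x n :
  step (npair (npair x n.+1) (npair (npair 8 (npair p q)) K)) =
  npair (npair x n) (npair (npair 8 (npair p q))
    (npair (npair 12 (npair q (npair x n))) K)).
Proof. one. Qed.
Lemma step_mu p x : step (npair x (npair (npair 9 p) K)) =
  npair (npair x 0) (npair p (npair (npair 13 (npair p (npair x 0))) K)).
Proof. one. Qed.
Lemma step_pair1 q x y : step (npair y (npair (npair 10 (npair q x)) K)) =
  npair x (npair q (npair (npair 11 y) K)).
Proof. one. Qed.
Lemma step_pair2 y z : step (npair z (npair (npair 11 y) K)) = npair (npair y z) K.
Proof. one. Qed.
Lemma step_prec1 q x n y :
  step (npair y (npair (npair 12 (npair q (npair x n))) K)) =
  npair (npair x (npair n y)) (npair q K).
Proof. one. Qed.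
Lemma step_mu0 p x n : step (npair 0 (npair (npair 13 (npair p (npair x n))) K)) =
  npair n K.
Proof. one. Qed.
Lemma step_muS p x n y : step (npair y.+1 (npair (npair 13 (npair p (npair x n))) K)) =
  npair (npair x n.+1) (npair p (npair (npair 13 (npair p (npair x n.+1))) K)).
Proof. one. Qed.
End Steps.

(** Induction on the computation, for every stack [K], because a subprogram runs on top of
    continuation frames. *)
Lemma machine_complete p x y : runs_to set0 p x y ->
  forall K, exists t, iter t step (npair x (npair (prog_code p) K)) = npair y K.
Proof.
elim=> {p x y} /=.
- by move=> x K; exists 1; exact: step_zero.
- by move=> x K; exists 1; exact: step_succ.
- by move=> x y K; exists 1; rewrite /= step_fst npairK.
- by move=> x y K; exists 1; rewrite /= step_snd npairK.
- by move=> x K; exists 1; rewrite /= step_oracle in_set0.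
- move=> p q x y z _ ihp _ ihq K.
  have [t1 h1] := ihp (npair (npair 10 (npair (prog_code q) x)) K).
  have [t2 h2] := ihq (npair (npair 11 y) K).
  exists (1 + (t1 + (1 + (t2 + 1)))).
  by rewrite !iterD_step /= step_pair h1 step_pair1 h2 step_pair2.
- move=> p q x y z _ ihq _ ihp K.
  have [t1 h1] := ihq (npair (prog_code p) K).
  have [t2 h2] := ihp K.
  by exists (1 + (t1 + t2)); rewrite !iterD_step /= step_comp h1 h2.
- move=> p q x y _ ih K; have [t h] := ih K.
  by exists (1 + t); rewrite !iterD_step /= step_prec0 h.
- move=> p q x n y z _ ih1 _ ih2 K.
  have [t1 h1] := ih1 (npair (npair 12 (npair (prog_code q) (npair x n))) K).
  have [t2 h2] := ih2 K.
  exists (1 + (t1 + (1 + t2))).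
  by rewrite !iterD_step /= step_precS h1 step_prec1 h2.
- move=> p x n v _ ih _ ih0 K.
  (* [st i] is the state in which the search is about to run its [i]-th test. *)
  pose st i := npair (npair x i) (npair (prog_code p)
     (npair (npair 13 (npair (prog_code p) (npair x i))) K)).
  have loop i : i <= n -> exists t, iter t step (st 0) = st i.
    elim: i => [|i IH] hi; first by exists 0.
    have [t ht] := IH (ltnW hi).
    have [t' ht'] := ih i hi (npair (npair 13 (npair (prog_code p) (npair x i))) K).
    by exists (t + (t' + 1)); rewrite !iterD_step /= ht ht' step_muS.
  have [t ht] := loop n (leqnn n).
  have [t' ht'] := ih0 (npair (npair 13 (npair (prog_code p) (npair x n))) K).
  exists (1 + (t + (t' + 1))).
  by rewrite !iterD_step /= step_mu -/(st 0) ht ht' step_mu0.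
Qed.

Lemma halted_pair v f K : 0 < f -> halted (npair v (npair f K)) = false.
Proof. by move=> h; rewrite /halted npairK; apply: negbTE; rewrite -lt0n npair_gt0. Qed.

(** Strong induction on the number of steps: before the stack can become empty, the frame of [p] and
    all it pushes above [K] must be consumed. The bound [t' <= t] keeps the time left for the next
    subprogram within reach of the induction hypothesis. *)
Lemma machine_sound t p x K :
  halted (iter t step (npair x (npair (prog_code p) K))) ->
  exists y t', [/\ t' <= t, runs_to set0 p x y &
    iter t' step (npair x (npair (prog_code p) K)) = npair y K].
Proof.
have [n] := ubnP t; elim: n => // n IH in t p x K *; rewrite ltnS => tn.
case: t tn => [|t] tn; first by rewrite /= halted_pair // prog_code_gt0.
have IH' t0 p0 x0 K0 : t0 <= t -> halted (iter t0 step (npair x0 (npair (prog_code p0) K0))) ->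
    exists y t', [/\ t' <= t0, runs_to set0 p0 x0 y &
      iter t' step (npair x0 (npair (prog_code p0) K0)) = npair y K0].
  by move=> h; apply: IH; exact: leq_ltn_trans tn.
(* Resuming a halting computation after [t'] steps. *)
have resume t0 t' s s' f v K0 : 0 < f -> t' <= t0 -> iter t' step s = npair v (npair f K0) ->
    step (npair v (npair f K0)) = s' -> halted (iter t0 step s) ->
    exists2 t1, t0 = t' + t1.+1 & halted (iter t1 step s').
  move=> f0 ht hs hs' hh.
  case: (t0 - t') (subnKC ht) => [|t1] e.
    by move: hh; rewrite -e addn0 hs halted_pair.
  by exists t1 => //; move: hh; rewrite -e iterD_step hs iterSr hs'.
rewrite iterSr.
case: p => [||||| p q | p q | p q | p] /=.
- by move=> _; exists 0, 1; split; [|exact: runs_zero|exact: step_zero].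
- by move=> _; exists x.+1, 1; split; [|exact: runs_succ|exact: step_succ].
- move=> _; exists (nfst x), 1; split=> //; last exact: step_fst.
  by rewrite -{1}(npairE x); exact: runs_fst.
- move=> _; exists (nsnd x), 1; split=> //; last exact: step_snd.
  by rewrite -{1}(npairE x); exact: runs_snd.
- move=> _; exists 0, 1; split=> //; last exact: step_oracle.
  by have := runs_oracle set0 x; rewrite in_set0.
- rewrite step_pair => hh.
  have [y [t1 [h1 r1 e1]]] := IH' _ _ _ _ (leqnn _) hh.
  have [t2 e2 hh2] := resume _ _ _ _ _ _ _ (npair_gt0 _ (isT : 0 < 10)) h1 e1 (step_pair1 _ _ _ _) hh.
  have t2t : t2 <= t by rewrite e2 -addSnnS leq_addl.
  have [z [t3 [h3 r3 e3]]] := IH' _ _ _ _ t2t hh2.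
  have [t4 e4 _] := resume _ _ _ _ _ _ _ (npair_gt0 _ (isT : 0 < 11)) h3 e3 (step_pair2 _ _ _) hh2.
  exists (npair y z), (1 + (t1 + (1 + (t3 + 1)))); split.
  + by rewrite e2 e4 !add1n ltnS leq_add2l ltnS leq_add2l.
  + exact: runs_pair.
  + by rewrite !iterD_step /= step_pair e1 step_pair1 e3 step_pair2.
- rewrite step_comp => hh.
  have [y [t1 [h1 r1 e1]]] := IH' _ _ _ _ (leqnn _) hh.
  have hh2 : halted (iter (t - t1) step (npair y (npair (prog_code p) K))).
    by move: hh; rewrite -{1}(subnKC h1) iterD_step e1.
  have [z [t3 [h3 r3 e3]]] := IH' _ _ _ _ (leq_subr _ _) hh2.
  exists z, (1 + (t1 + t3)); split.
  + by rewrite add1n ltnS -(subnKC h1) leq_add2l.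
  + exact: runs_comp r1 r3.
  + by rewrite !iterD_step /= step_comp e1 e3.
- rewrite -(npairE x); case: (nsnd x) => [|m]; move: (nfst x) => {}x.
  + rewrite step_prec0 => hh.
    have [y [t1 [h1 r1 e1]]] := IH' _ _ _ _ (leqnn _) hh.
    by exists y, t1.+1; split; [|exact: runs_prec0|rewrite iterSr step_prec0].
  + rewrite step_precS => hh.
    have [y [t1 [h1 r1 e1]]] := IH' t (Prec p q) _ _ (leqnn _) hh.
    have [t2 e2 hh2] := resume _ _ _ _ _ _ _ (npair_gt0 _ (isT : 0 < 12)) h1 e1 (step_prec1 _ _ _ _ _) hh.
    have t2t : t2 <= t by rewrite e2 -addSnnS leq_addl.
    have [z [t3 [h3 r3 e3]]] := IH' _ _ _ _ t2t hh2.
    exists z, (1 + (t1 + (1 + t3))); split.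
    * by rewrite e2 !add1n ltnS leq_add2l ltnS.
    * exact: runs_precS r1 r3.
    * by rewrite !iterD_step /= step_precS e1 step_prec1 e3.
- rewrite step_mu.
  pose st i := npair (npair x i) (npair (prog_code p)
     (npair (npair 13 (npair (prog_code p) (npair x i))) K)).
  rewrite -/(st 0).
  (* The search needs an inner induction on the remaining time; [v] holds the values of the tests
     already passed. *)
  suff loop t0 i v : t0 <= t ->
      (forall j, j < i -> runs_to set0 p (npair x j) (v j).+1) ->
      halted (iter t0 step (st i)) ->
      exists y t', [/\ t' <= t0, runs_to set0 (Mu p) x y & iter t' step (st i) = npair y K].
    move=> hh; have [//|y [t1 [h1 r1 e1]]] := loop t 0 (fun=> 0) (leqnn _) _ hh.
    by exists y, t1.+1; split=> //; rewrite iterSr step_mu.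
  have [b] := ubnP t0; elim: b => // b IHb in t0 i v *; rewrite ltnS => tb t0t hv hh.
  have [y [t1 [h1 r1 e1]]] := IH' _ _ _ _ t0t hh.
  case: y r1 e1 => [|y] r1 e1.
    have [t2 e2 _] := resume _ _ _ _ _ _ _ (npair_gt0 _ (isT : 0 < 13)) h1 e1 (step_mu0 _ _ _ _) hh.
    exists i, (t1 + 1); split; first by rewrite e2 leq_add2l.
      exact: runs_mu hv r1.
    by rewrite iterD_step e1 /= step_mu0.
  have [t2 e2 hh2] := resume _ _ _ _ _ _ _ (npair_gt0 _ (isT : 0 < 13)) h1 e1 (step_muS _ _ _ _ _) hh.
  have t2t0 : t2 < t0 by rewrite e2 -addSnnS ltnS leq_addl.
  have [||||z [t3 [h3 r3 e3]]] := IHb t2 i.+1 (fun j => if j == i then y else v j) => //.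
  + exact: leq_trans t2t0 tb.
  + exact: leq_trans (ltnW t2t0) t0t.
  + by move=> j; rewrite ltnS leq_eqVlt; case: eqP => [-> _|_ /=]; [|exact: hv].
  exists z, (t1 + (1 + t3)); split=> //.
    by rewrite e2 leq_add2l add1n ltnS.
  by rewrite !iterD_step e1 /= step_muS.
Qed.

Lemma iter_halted t s : halted s -> iter t step s = s.
Proof. by move=> h; elim: t => //= t ->; rewrite /step; rewrite /halted in h; rewrite h. Qed.

Lemma result_mono t t' e x y : t <= t' -> result t e x = y.+1 -> result t' e x = y.+1.
Proof.
move=> /subnKC <-; rewrite /result iterD_step.
by case: ifP => // h [<-]; rewrite iter_halted // h.
Qed.

Lemma result_complete p x y : computes p x y ->
  exists t, result t (prog_code p) x = y.+1.
Proof.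
move=> h; have [t ht] := machine_complete h 0.
by exists t; rewrite /result ht /halted !npairK.
Qed.

Lemma result_sound t p x : result t (prog_code p) x != 0 -> exists y, computes p x y.
Proof.
rewrite /result; case: ifP => // h _.
by have [y [t' [_ r _]]] := machine_sound h; exists y.
Qed.

Lemma result_inj t t' e x y y' : result t e x = y.+1 -> result t' e x = y'.+1 -> y = y'.
Proof.
move=> h h'; have := result_mono (leq_maxl t t') h.
by rewrite (result_mono (leq_maxr t t') h') => -[].
Qed.

(* Extended below by [::=] as further functions are shown to be recursive. *)
Ltac rec_ext := fail.

(** Recursion on the syntax of the function; subgoals of unknown shape are left to the user. *)
Ltac rec_tac := cbv beta zeta; lazymatch goal with
  | |- rec_in _ (fun x => x) => exact: rec_id
  | |- rec_in _ nfst => exact: rec_fst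
  | |- rec_in _ nsnd => exact: rec_snd
  | |- rec_in ?A (fun x => npair (@?f x) (@?g x)) => apply: (@rec_pair A f g); rec_tac
  | |- rec_in ?A (fun x => nfst (@?f x)) => apply: (@rec_fst1 A f); rec_tac
  | |- rec_in ?A (fun x => nsnd (@?f x)) => apply: (@rec_snd1 A f); rec_tac
  | |- rec_in ?A (fun x => (@?f x).+1) => apply: (@rec_S A f); rec_tac
  | |- rec_in ?A (fun x => (@?f x).-1) => apply: (@rec_pred A f); rec_tac
  | |- rec_in ?A (fun x => @?f x + @?g x) => apply: (@rec_add A f g); rec_tac
  | |- rec_in ?A (fun x => @?f x - @?g x) => apply: (@rec_sub A f g); rec_tac
  | |- rec_in ?A (fun x => @?f x * @?g x) => apply: (@rec_mul A f g); rec_tac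
  | |- rec_in ?A (fun x => 2 ^ @?f x) => apply: (@rec_exp2 A f); rec_tac
  | |- rec_in ?A (fun x => @?f x %/ 2 ^ @?g x) => apply: (@rec_div2exp A f g); rec_tac
  | |- rec_in ?A (fun x => bsum (@?n x) (@?F x)) =>
      apply: (@rec_sum A n F); rec_tac
  | |- rec_in ?A (fun x => nat_of_bool (~~ @?b x)) => apply: (@rec_neg A b); rec_tac
  | |- rec_in ?A (fun x => nat_of_bool (@?b x && @?c x)) => apply: (@rec_and A b c); rec_tac
  | |- rec_in ?A (fun x => nat_of_bool (@?b x || @?c x)) => apply: (@rec_or A b c); rec_tac
  | |- rec_in ?A (fun x => nat_of_bool (@?b x ==> @?c x)) => apply: (@rec_imply A b c); rec_tac
  | |- rec_in ?A (fun x => nat_of_bool (@?f x <= @?g x)) => apply: (@rec_le A f g); rec_tac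
  | |- rec_in ?A (fun x => nat_of_bool (@?f x == @?g x)) =>
      first [apply: (@rec_eqn A f g) | apply: (@rec_eqb A f g)]; rec_tac
  | |- rec_in ?A (fun x => nat_of_bool (odd (@?f x))) => apply: (@rec_odd A f); rec_tac
  | |- rec_in ?A (fun x => nat_of_bool (@?f x \in _)) => apply: (@rec_oracle A f); rec_tac
  | |- rec_in ?A (fun x => nat_of_bool (ball (@?n x) (@?P x))) =>
      apply: (@rec_forall A n P); rec_tac
  | |- rec_in ?A (fun x => nat_of_bool (bex (@?n x) (@?P x))) =>
      apply: (@rec_exists A n P); rec_tac
  | |- rec_in _ (fun x => nat_of_bool _) =>
      tryif first [rec_ext | refine (rec_ifb _ _ _)] then rec_tac else idtac
  | |- rec_in _ _ =>
      tryif first [refine (rec_const _ _) | rec_ext | refine (rec_if _ _ _)]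
      then rec_tac else idtac
  | |- _ => idtac
  end.

Lemma rec_step A : rec_in A step.
Proof.
rewrite /step. rec_tac.
Qed.


Section RecResult.
Variable A : set nat.

Lemma rec_iter f n s : rec_in A f -> rec_in A n -> rec_in A s ->
  rec_in A (fun x => iter (n x) f (s x)).
Proof.
move=> rf rn rs; apply: (rec_eq (f := fun x => prim s (fun w => f (nsnd (nsnd w))) x (n x))).
  by move=> x; elim: (n x) => //= k ->; rewrite !npairK.
by apply: rec_prim => //; [apply: rec_comp => //|]; rec_tac.
Qed.

Lemma rec_result t e x : rec_in A t -> rec_in A e -> rec_in A x ->
  rec_in A (fun z => result (t z) (e z) (x z)).
Proof.
move=> rt re rx; rewrite /result /halted.
have rs : rec_in A (fun z => iter (t z) step (npair (x z) (npair (e z) 0))).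
  by apply: rec_iter => //; [exact: rec_step|rec_tac].
apply: rec_if; last exact: rec_const.
  exact: rec_eqn (rec_snd1 rs) (rec_const _ _).
exact: rec_S (rec_fst1 rs).
Qed.

End RecResult.

Ltac rec_ext ::= lazymatch goal with
  | |- rec_in _ (fun x => result _ _ _) => refine (rec_result _ _ _)
  | |- rec_in ?A _ => assumption
  end.

Definition bit (c x : nat) : bool := odd (x %/ 2 ^ c).

Lemma rec_bit A c x : rec_in A c -> rec_in A x -> rec_in A (fun z => bit (c z) (x z)).
Proof. by move=> rc rx; rewrite /bit; rec_tac. Qed.

(** * Finite sets as bit masks, strings, and volumes *)

Lemma bit_lt c x : bit c x -> c < x.
Proof.
rewrite /bit; apply: contraTT; rewrite -leqNgt => h.
by rewrite divn_small // (leq_ltn_trans h) // ltn_expl.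
Qed.

Lemma bit_small c x n : x < 2 ^ n -> n <= c -> bit c x = false.
Proof.
move=> h nc; rewrite /bit divn_small // (leq_trans h) //.
by rewrite leq_exp2l.
Qed.

Lemma bit_rec c x : bit c.+1 x = bit c x./2.
Proof. by rewrite /bit expnS divnMA divn2. Qed.

Lemma bit_inj x y : (forall c, bit c x = bit c y) -> x = y.
Proof.
have [n] : exists n, x < 2 ^ n /\ y < 2 ^ n.
  exists (x + y); split; first exact: leq_ltn_trans (leq_addr y x) (ltn_expl _ _).
  exact: leq_ltn_trans (leq_addl x y) (ltn_expl _ _).
elim: n => [|n IH] in x y *; first by case: x y => [|x] [|y] [].
rewrite expnS => -[xn yn] h.
have o := h 0; rewrite /bit !expn0 !divn1 in o.
rewrite -(odd_double_half x) -(odd_double_half y) o; congr (_ + _.*2).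
by apply: IH => [|c]; [rewrite -!divn2; lia|rewrite -!bit_rec].
Qed.

Definition mask (n : nat) (P : pred nat) : nat := bsum n (fun i => P i * 2 ^ i).

Lemma bsumS n F : bsum n.+1 F = bsum n F + F n.
Proof. by rewrite /bsum big_ord_recr. Qed.

Lemma bsumSl n F : bsum n.+1 F = F 0 + bsum n (fun i => F i.+1).
Proof. by rewrite /bsum big_ord_recl. Qed.

Lemma bsum0 F : bsum 0 F = 0.
Proof. by rewrite /bsum big_ord0. Qed.

Lemma eq_bsum n F G : (forall i, i < n -> F i = G i) -> bsum n F = bsum n G.
Proof. by move=> h; apply: eq_bigr => i _; exact: h. Qed.

Lemma leq_bsum n F G : (forall i, i < n -> F i <= G i) -> bsum n F <= bsum n G.
Proof. by move=> h; apply: leq_sum => i _; exact: h. Qed.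

Lemma bsumD n F G : bsum n (fun i => F i + G i) = bsum n F + bsum n G.
Proof. by rewrite /bsum big_split. Qed.

Lemma bsumMl n a F : bsum n (fun i => a * F i) = a * bsum n F.
Proof. by rewrite /bsum big_distrr. Qed.

Lemma bsumMr n a F : bsum n (fun i => F i * a) = bsum n F * a.
Proof. by rewrite /bsum big_distrl. Qed.

Lemma bsum_cst n a : bsum n (fun=> a) = n * a.
Proof. by rewrite /bsum sum_nat_const card_ord. Qed.

Lemma exchange_bsum n m (F : nat -> nat -> nat) :
  bsum n (fun i => bsum m (F i)) = bsum m (fun j => bsum n (F^~ j)).
Proof. by rewrite /bsum exchange_big. Qed.

Lemma mask_lt n P : mask n P < 2 ^ n.
Proof.
elim: n => [|n ih]; rewrite /mask ?bsum0 // bsumS expnS -/(mask n P).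
by case: (P n); lia.
Qed.

Lemma bit_mask n P c : bit c (mask n P) = (c < n) && P c.
Proof.
elim: c n P => [|c IH] [|n] P; try by rewrite /mask /bit bsum0 div0n.
- rewrite /bit expn0 divn1 /mask bsumSl expn0 muln1 oddD oddb.
  rewrite (@eq_bsum n _ (fun i => 2 * (P i.+1 * 2 ^ i))); last by move=> *; rewrite expnS; lia.
  by rewrite bsumMl oddM addbF.
- rewrite bit_rec ltnS -(IH n (fun i => P i.+1)); congr (bit _ _).
  rewrite /mask bsumSl expn0 muln1.
  rewrite (@eq_bsum n _ (fun i => 2 * (P i.+1 * 2 ^ i))); last by move=> *; rewrite expnS; lia.
  by rewrite bsumMl mul2n half_bit_double.
Qed.

(** Cardinality of the finite set with mask [W]; by [bit_lt], all its elements are below [W]. *)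
Definition pop (W : nat) : nat := bsum W (fun c => bit c W).

Lemma bsum_widen n m F : n <= m -> (forall i, n <= i -> F i = 0) -> bsum m F = bsum n F.
Proof.
move=> /subnKC <- h; elim: (m - n) => [|k ih]; first by rewrite addn0.
by rewrite addnS bsumS h ?addn0 // leq_addr.
Qed.

Lemma popE D t : D <= t -> pop D = bsum t (fun c => bit c D).
Proof.
move=> h; rewrite (bsum_widen h) // => i hi.
by case: (boolP (bit i D)) => // /bit_lt; rewrite ltnNge hi.
Qed.

(* Numbers below [2 ^ t] stand for strings of length [t], read from the most
   significant bit. *)
Definition xbit (t x c : nat) : bool := odd (x %/ 2 ^ (t - c.+1)).

(** Closed form of [string_code] on the prefix of length [k] of [x], in a shape that [rec_tac] can
    handle. *)
Definition pcode (t x k : nat) : nat := bsum k (fun i => (xbit t x i).+1 * 2 ^ i).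

Lemma string_code_mkseq t x k : string_code (mkseq (xbit t x) k) = pcode t x k.
Proof.
rewrite /pcode; elim: k (xbit t x) => [|k ih] f; first by rewrite bsum0.
rewrite /mkseq /= -[X in map f X]/(iota (1 + 0) k) iotaDl -map_comp.
rewrite -/(mkseq (f \o addn 1) k) ih bsumSl expn0 muln1 addnC; congr (_ + _).
by rewrite -mul2n -bsumMl; apply: eq_bsum => i _; rewrite expnS /= add1n; lia.
Qed.

Lemma xbit_trunc t t' y c : c < t -> t <= t' ->
  xbit t (y %/ 2 ^ (t' - t)) c = xbit t' y c.
Proof.
by move=> ct tt; rewrite /xbit -divnMA -expnD; congr (odd (_ %/ 2 ^ _)); lia.
Qed.

Lemma pcode_trunc t t' y k : k <= t -> t <= t' ->
  pcode t (y %/ 2 ^ (t' - t)) k = pcode t' y k.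
Proof.
move=> kt tt; apply: eq_bsum => i ik.
by rewrite xbit_trunc // (leq_trans ik).
Qed.

(* With m * m.+1 positions used before stage m, the volume at stage m is at least
   2^-(level m): each stage loses a factor 2^(2m+2) to the new positions, a factor 2
   to the coding and a factor 2 to the new test component, whose index
   [level m.+1] makes it small enough. *)
Definition level (m : nat) : nat := m * m + 3 * m.

(** Stage [t] of the event that [x] meets component [n] of test [e]: the length of the string also
    bounds the running time. *)
Definition hit (e n t x : nat) : bool :=
  bex t.+1 (fun k => result t e (npair n (pcode t x k)) != 0).

(** The mask [B] holds the bits coded before stage [m]; an index with first component 1 and bit 1 is
    an accepted test. *)
Definition avoid (m B t x : nat) : bool :=
  ball m (fun i => (nfst i == 1) && bit i B ==> ~~ hit (nsnd i) (level i.+1) t x).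

Definition agree (D E t x : nat) : bool :=
  ball t (fun c => bit c D ==> (xbit t x c == bit c E)).

Definition ok (m B D E t x : nat) : bool := agree D E t x && avoid m B t x.

Definition volume (m B D E t : nat) : nat := bsum (2 ^ t) (fun x => ok m B D E t x).

(** Relative volume at least twice the [2 ^- level m.+1] required at the next stage; the surplus
    pays for one new test component. *)
Definition good (m B D E t : nat) : bool :=
  2 ^ t <= volume m B D E t * 2 ^ (level m.+1).-1.

(** [G] is a subset of [D'] that extends the assignment [E] on [D]; the bound [2 ^ D'] makes the
    search for candidates finite. *)
Definition cand (D E D' G : nat) : bool :=
  (G < 2 ^ D') &&
  ball D' (fun c => (bit c G ==> bit c D') && (bit c D ==> (bit c G == bit c E))).

Lemma hit_trunc e n t t' y : t <= t' -> hit e n t (y %/ 2 ^ (t' - t)) -> hit e n t' y.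
Proof.
move=> tt /bexP[k]; rewrite ltnS => kt.
rewrite pcode_trunc //; case E: (result _ _ _) => [|r] // _.
by apply/bexP; exists k; [exact: leq_trans tt|rewrite (result_mono tt E)].
Qed.

Lemma avoid_trunc m B t t' y : t <= t' -> avoid m B t' y -> avoid m B t (y %/ 2 ^ (t' - t)).
Proof.
move=> tt /ballP h; apply/ballP => i /h/implyP h'; apply/implyP => /h'.
by apply: contra; exact: hit_trunc.
Qed.

Lemma agree_trunc D E t t' y : t <= t' -> agree D E t' y -> agree D E t (y %/ 2 ^ (t' - t)).
Proof.
move=> tt /ballP h; apply/ballP => c ct; rewrite xbit_trunc //.
by apply: h; exact: leq_trans tt.
Qed.

Lemma ok_trunc m B D E t t' y : t <= t' -> ok m B D E t' y -> ok m B D E t (y %/ 2 ^ (t' - t)).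
Proof. by move=> tt /andP[h1 h2]; rewrite /ok agree_trunc // avoid_trunc. Qed.

Lemma bsum_double n F : bsum (2 * n) F = bsum n (fun y => F y.*2 + F y.*2.+1).
Proof.
elim: n => [|n ih]; first by rewrite !bsum0.
by rewrite mulnS !bsumS ih mul2n addnA.
Qed.

Lemma volumeS m B D E t : volume m B D E t.+1 <= volume m B D E t * 2.
Proof.
rewrite /volume expnS bsum_double -bsumMr; apply: leq_bsum => y _.
have h z : z./2 = y -> ok m B D E t.+1 z <= ok m B D E t y.
  move=> <-; case h: (ok _ _ _ _ t.+1 z) => //.
  by have := ok_trunc (leqnSn t) h; rewrite subSnn divn2 => ->.
rewrite muln2 -(addnn (ok m B D E t y)) leq_add // h ?doubleK //.
by rewrite -[_.+1]/(true + _) half_bit_double.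
Qed.

(** The relative volume can only decrease with the stage, so the failure of [good] is permanent:
    being good at all stages is a co-c.e. property. *)
Lemma good_mono m B D E t t' : t <= t' -> good m B D E t' -> good m B D E t.
Proof.
move=> /subnKC <-; elim: (t' - t) => [|k ih]; first by rewrite addn0.
move=> h; apply: ih; move: h; rewrite /good addnS expnS.
have := volumeS m B D E (t + k); set v := volume _ _ _ _ _; set w := volume _ _ _ _ _.
move=> vw h; have := leq_trans h (leq_mul vw (leqnn _)).
by rewrite mulnAC [X in _ <= X]mulnC leq_pmul2l.
Qed.

Lemma xbitS t y (b : bool) c : c < t -> xbit t.+1 (b + y.*2) c = xbit t y c.
Proof.
by move=> ct; rewrite -(@xbit_trunc t t.+1) // subSnn expn1 divn2 half_bit_double.
Qed.

Lemma xbitSt t y (b : bool) : xbit t.+1 (b + y.*2) t = b.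
Proof. by rewrite /xbit subnn expn0 divn1 oddD odd_double; case: b. Qed.

Lemma agreeS D E t y (b : bool) :
  agree D E t.+1 (b + y.*2) = agree D E t y && (bit t D ==> (b == bit t E)).
Proof.
apply/ballP/andP => [h|[/ballP h1 h2] c].
  split; last by have := h t (ltnSn t); rewrite xbitSt.
  by apply/ballP => c ct; have := h c (leqW ct); rewrite xbitS.
rewrite ltnS leq_eqVlt => /predU1P[->|ct]; first by rewrite xbitSt.
by rewrite xbitS // h1.
Qed.

(** Each position of [D] below [t] halves the number of strings; the product form avoids
    division. *)
Lemma card_agree D E t :
  bsum (2 ^ t) (agree D E t) * 2 ^ bsum t (fun c => bit c D) = 2 ^ t.
Proof.
elim: t => [|t ih].
  rewrite bsum0 muln1 expn0 bsumS bsum0 add0n.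
  by have -> : agree D E 0 0 by apply/ballP.
rewrite expnS bsum_double bsumS expnD mulnA.
rewrite (@eq_bsum _ _ (fun y => agree D E t y * (if bit t D then 1 else 2))); last first.
  move=> y _; have := agreeS D E t y false; have := agreeS D E t y true.
  rewrite add0n add1n => -> ->.
  by case: (agree D E t y) (bit t D) (bit t E) => [] [] [].
rewrite bsumMr -[in RHS]ih; move: (bsum (2 ^ t) _) (2 ^ bsum _ _) => N P.
by case: (bit t D) => /=; rewrite ?expn0 ?expn1; lia.
Qed.

Lemma volume_le m B D E t : D <= t -> volume m B D E t * 2 ^ pop D <= 2 ^ t.
Proof.
move=> Dt; rewrite (popE Dt) -(card_agree D E t) leq_mul2r; apply/orP; right.
by apply: leq_bsum => x _; rewrite /ok; case: agree; rewrite ?leq_b1.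
Qed.

(** * Extensions of an assignment to a larger set of coding positions *)

Section Candidates.
Variables (D E D' : nat).
Hypothesis sub : forall c, bit c D -> bit c D'.

Lemma candP G : reflect [/\ G < 2 ^ D', forall c, bit c G -> bit c D' &
  forall c, bit c D -> bit c G = bit c E] (cand D E D' G).
Proof.
apply: (iffP andP) => [[GD /ballP h]|[GD h1 h2]].
  split=> // c hc.
    have [/(bit_small GD)|/h/andP[/implyP h' _]] := leqP D' c; last exact: h'.
    by rewrite hc.
  by have /h/andP[_ /implyP/(_ hc)/eqP] := bit_lt (sub hc).
split=> //; apply/ballP => c _; apply/andP; split; apply/implyP => hc; first exact: h1.
by rewrite h2.
Qed.

Lemma cand_inj G G' : cand D E D' G -> cand D E D' G' ->
  (forall c, bit c D' -> bit c G = bit c G') -> G = G'.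
Proof.
move=> /candP[_ h _] /candP[_ h' _] H; apply: bit_inj => c.
case: (boolP (bit c D')) => [/H //|n].
by rewrite (negbTE (contra (h c) n)) (negbTE (contra (h' c) n)).
Qed.

Lemma agree_cand t x : D' <= t -> agree D E t x ->
  exists G, cand D E D' G /\ agree D' G t x.
Proof.
move=> Dt /ballP h; exists (mask D' (fun c => bit c D' && xbit t x c)); split.
  apply/candP; split; [exact: mask_lt|by move=> c; rewrite bit_mask => /and3P[]|].
  move=> c hc; rewrite bit_mask (sub hc) bit_lt ?sub //=.
  have /h : c < t by apply: leq_trans Dt; apply: bit_lt; exact: sub.
  by rewrite hc => /eqP.
apply/ballP => c ct; apply/implyP => hc.
by rewrite bit_mask hc bit_lt.
Qed.

Lemma cand_agree t x G : D' <= t -> cand D E D' G -> agree D' G t x -> agree D E t x.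
Proof.
move=> Dt /candP[_ _ h] /ballP h'; apply/ballP => c ct; apply/implyP => hc.
by rewrite -h //; have := h' c ct; rewrite (sub hc).
Qed.

(** Double counting: the strings of length [D'] that agree with [E] on [D] contain disjoint classes,
    one for each candidate, all of the same size by [card_agree]. *)
Lemma card_cand : bsum (2 ^ D') (cand D E D') * 2 ^ pop D <= 2 ^ pop D'.
Proof.
have DD : forall t, D' <= t -> pop D = bsum t (fun c => bit c D).
  move=> t h; have [/popE//|tD] := leqP D t.
  rewrite (popE (leqnn D)) (bsum_widen (ltnW tD)) // => i hi.
  by case: (boolP (bit i D)) => // /sub/bit_lt; rewrite ltnNge (leq_trans h).
have n0 : 0 < bsum (2 ^ D') (agree D E D').
  by have := card_agree D E D'; case: bsum => // /eqP; rewrite mul0n eq_sym expn_eq0.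
rewrite (DD D') //.
have h : bsum (2 ^ D') (fun G => cand D E D' G * bsum (2 ^ D') (agree D' G D')) <=
    bsum (2 ^ D') (agree D E D').
  rewrite (@eq_bsum _ _ (fun G => bsum (2 ^ D') (fun x => cand D E D' G && agree D' G D' x))).
    rewrite exchange_bsum; apply: leq_bsum => x _.
    (* A string determines its candidate, so it is counted at most once. *)
    have [/existsP[/= G0 /andP[c0 a0]]|/existsPn h] :=
      boolP [exists G : 'I_(2 ^ D'), cand D E D' G && agree D' G D' x].
      rewrite (cand_agree _ c0 a0) // /bsum (bigD1 G0) //= c0 a0 big1 // => G nG.
      apply/eqP; rewrite eqb0; apply: contra nG => /andP[c1 a1]; apply/eqP/val_inj => /=.
      apply: cand_inj => // c hc.
      move/ballP: a0 => /(_ c (bit_lt hc)); rewrite hc /= => /eqP <-.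
      by move/ballP: a1 => /(_ c (bit_lt hc)); rewrite hc /= => /eqP <-.
    by rewrite /bsum big1 // => G _; apply/eqP; rewrite eqb0.
  by move=> G _; rewrite -bsumMl; apply: eq_bsum => x _; rewrite mulnb.
have e G : bsum (2 ^ D') (agree D' G D') * 2 ^ pop D' = 2 ^ D'.
  by rewrite (popE (leqnn D')) card_agree.
have := card_agree D E D'; set N := bsum _ (agree D E D') in n0 h * => eN.
rewrite -(leq_pmul2l n0) mulnCA eN.
have h1 : bsum (2 ^ D') (cand D E D') * 2 ^ D' =
    bsum (2 ^ D') (fun G => cand D E D' G * bsum (2 ^ D') (agree D' G D')) * 2 ^ pop D'.
  by rewrite -!bsumMr; apply: eq_bsum => G _; rewrite -mulnA e.
by rewrite h1 leq_mul2r h orbT.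
Qed.

Lemma volume_cand m B t : D' <= t ->
  volume m B D E t <= bsum (2 ^ D') (fun G => cand D E D' G * volume m B D' G t).
Proof.
move=> Dt.
rewrite (@eq_bsum _ _ (fun G => bsum (2 ^ t) (fun x => cand D E D' G && ok m B D' G t x))).
  rewrite exchange_bsum; apply: leq_bsum => x _.
  case h: (ok m B D E t x) => //; move/andP: h => [h1 h2].
  have [G [cG aG]] := agree_cand Dt h1.
  have GD : G < 2 ^ D' by case/candP: cG.
  by rewrite /bsum (bigD1 (Ordinal GD)) //= cG /ok aG h2.
by move=> G _; rewrite -bsumMl; apply: eq_bsum => x _; rewrite mulnb.
Qed.

(* At most one good candidate would leave too small a total volume: a single
   candidate has relative volume 2^-(pop D'), and the bad ones together have less
   than 2^(pop D' - pop D) * 2^-(level m.+1).-1. *)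
Lemma two_good_at m B t : D' <= t -> pop D = m * m.+1 -> pop D' = m.+1 * m.+2 ->
  2 ^ t <= volume m B D E t * 2 ^ level m ->
  exists G1 G2, [/\ G1 < G2, cand D E D' G1 && good m B D' G1 t &
    cand D E D' G2 && good m B D' G2 t].
Proof.
move=> Dt pD pD' hv; apply: contrapT => no.
pose g G := cand D E D' G && good m B D' G t.
have uniq G1 G2 : g G1 -> g G2 -> G1 = G2.
  by move=> h1 h2; case: (ltngtP G1 G2) => // h; case: no; [exists G1, G2|exists G2, G1].
set q' := (level m.+1).-1 in no *.
pose V := bsum (2 ^ D') (fun G => cand D E D' G * volume m B D' G t).
pose V1 := bsum (2 ^ D') (fun G => g G * volume m B D' G t).
pose V2 := bsum (2 ^ D') (fun G => (cand D E D' G && ~~ g G) * volume m B D' G t).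
have VE : V = V1 + V2.
  rewrite /V /V1 /V2 -bsumD; apply: eq_bsum => G _; rewrite -mulnDl; congr (_ * _).
  by rewrite /g; case: cand => //; case: good.
have hV1 : V1 * 2 ^ (m.+1 * m.+2) <= 2 ^ t.
  have [/existsP[/= G0 g0]|/existsPn h] := boolP [exists G : 'I_(2 ^ D'), g G].
    rewrite /V1 /bsum (bigD1 G0) //= g0 mul1n big1 ?addn0 ?(leq_trans _ (volume_le m B G0 Dt)) ?pD' // => G nG.
    by case: (boolP (g G)) => // h; case/eqP: nG; apply/val_inj/uniq.
  by rewrite /V1 /bsum big1 // => G _; rewrite (negbTE (h G)).
have hV2 : V2 * 2 ^ q' <= bsum (2 ^ D') (cand D E D') * 2 ^ t.
  rewrite /V2 -!bsumMr; apply: leq_bsum => G _.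
  case: (boolP (cand D E D' G && ~~ g G)) => [/andP[c]|_]; last by rewrite !mul0n.
  by rewrite /g c !mul1n /good -ltnNge => /ltnW.
have hC : bsum (2 ^ D') (cand D E D') <= 2 ^ (2 * m + 2).
  have := card_cand; rewrite pD pD'.
  have -> : m.+1 * m.+2 = 2 * m + 2 + m * m.+1 by lia.
  by rewrite expnD leq_pmul2r // expn_gt0.
have hV : volume m B D E t <= V1 + V2 by rewrite -VE; exact: volume_cand.
(* Since [level m.+1 = level m + 2 * m + 4], the exponent in [good] exceeds [level m] by
   [2 * m + 3]. *)
have lm : level m + (2 * m + 3) = q' by rewrite /q' /level; lia.
have pm : m.+1 * m.+2 = level m + 2 by rewrite /level; lia.
have {hv} : 2 ^ t * 2 ^ (2 * m + 3) <= (V1 + V2) * 2 ^ q'.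
  rewrite -lm (expnD 2 (level m)) mulnA leq_mul2r (leq_trans hv) ?orbT //.
  by rewrite leq_mul2r hV orbT.
rewrite mulnDl; move: hV1; rewrite pm => hV1.
have q'E : q' = level m + 2 + (2 * m + 1) by rewrite -lm; lia.
have a1 : V1 * 2 ^ q' <= 2 ^ t * 2 ^ (2 * m + 1).
  by rewrite q'E (expnD 2 (level m + 2)) mulnA leq_mul2r hV1 orbT.
have a2 : V2 * 2 ^ q' <= 2 ^ (2 * m + 2) * 2 ^ t.
  by rewrite (leq_trans hV2) // leq_mul2r hC orbT.
have e k : 2 ^ (2 * m + k) = 2 ^ k * 2 ^ (2 * m) by rewrite addnC expnD.
have t0 : 0 < 2 ^ t * 2 ^ (2 * m) by rewrite muln_gt0 !expn_gt0.
rewrite !e -[2 ^ 1]/2 -[2 ^ 2]/4 -[2 ^ 3]/8 in a1 a2 *.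
(* The scaled total is at least [8 * a * b], but the single good candidate gives at most [2 * a * b]
   and the bad ones at most [4 * a * b]. *)
move: (V1 * _) (V2 * _) a1 a2 => x y; move: (2 ^ t) (2 ^ (2 * m)) t0 => a b.
by move=> *; nia.
Qed.

Definition always_good m B G := cand D E D' G /\ forall t, D' <= t -> good m B D' G t.

(** Compactness: there are finitely many candidates, so at a stage beyond the failure stages of all
    that ever fail, the good ones are good forever. *)
Lemma two_always_good m B : pop D = m * m.+1 -> pop D' = m.+1 * m.+2 ->
  (forall t, D' <= t -> 2 ^ t <= volume m B D E t * 2 ^ level m) ->
  exists G1 G2, [/\ G1 < G2, always_good m B G1 & always_good m B G2].
Proof.
move=> pD pD' hv.
have [f hf] : exists f : nat -> nat, forall G, ~ (forall t, D' <= t -> good m B D' G t) ->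
    D' <= f G /\ ~~ good m B D' G (f G).
  have : forall G, exists t, ~ (forall t, D' <= t -> good m B D' G t) ->
      D' <= t /\ ~~ good m B D' G t.
    move=> G; have [h|h] := pselect (forall t, D' <= t -> good m B D' G t); first by exists 0.
    apply: contrapT => H; apply: h => t Dt; apply: contrapT => /negP ng.
    by apply: H; exists t.
  by move=> H; case: (boolp.choice H) => f hf; exists f.
pose T := D' + \sum_(G < 2 ^ D') f G.
have DT : D' <= T by exact: leq_addr.
have [G1 [G2 [lt12 h1 h2]]] := two_good_at DT pD pD' (hv _ DT).
suff ag G : cand D E D' G && good m B D' G T -> always_good m B G.
  by exists G1, G2; split=> //; exact: ag.
move=> /andP[c g]; split=> //; apply: contrapT => /hf[_ /negP[]].
have GD : G < 2 ^ D' by case/candP: c.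
apply: good_mono g.
by rewrite /T (bigD1 (Ordinal GD)) //= addnCA leq_addr.
Qed.

End Candidates.

(** * Construction of the coding sequence *)

(** König's lemma for countably many trees at once. As [P] decreases with [m], it suffices to follow
    strings that have extensions of every length in every tree. *)
Lemma konig (P : nat -> nat -> nat -> bool) :
  (forall m t t' y, t <= t' -> P m t' y -> P m t (y %/ 2 ^ (t' - t))) ->
  (forall m m' t y, m <= m' -> P m' t y -> P m t y) ->
  (forall m t, exists2 x, x < 2 ^ t & P m t x) ->
  exists Z : nat -> bool, forall m t, exists2 x, P m t x &
    forall c, c < t -> xbit t x c = Z c.
Proof.
move=> trunc anti ex.
pose ext t x := x < 2 ^ t /\ forall m t', t <= t' ->
  exists y, [/\ y < 2 ^ t', y %/ 2 ^ (t' - t) = x & P m t' y].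
have ext0 : ext 0 0.
  split=> // m t' _; have [y y1 y2] := ex m t'; exists y; split=> //.
  by rewrite subn0 divn_small.
have extS t x : ext t x -> exists b : bool, ext t.+1 (b + x.*2).
  move=> [xt h]; apply: contrapT => no.
  have bad (b : bool) : exists m t', t < t' /\ forall y, y < 2 ^ t' ->
      y %/ 2 ^ (t' - t.+1) = b + x.*2 -> ~~ P m t' y.
    apply: contrapT => H; apply: no; exists b; split.
      by rewrite expnS; have := leq_b1 b; lia.
    move=> m t' tt'; apply: contrapT => H'; apply: H; exists m, t'; split=> // y yt ye.
    by apply/negP => Py; apply: H'; exists y.
  (* If both one-bit extensions of [x] were refuted, a witness for [x] at the maximal level and
     length would truncate to a contradiction with one refutation. *)
  have [m0 [t0 [h0 b0]]] := bad false; have [m1 [t1 [h1 b1]]] := bad true.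
  pose t' := maxn t0 t1.
  have tt' : t < t' by rewrite leq_max h0.
  have [y [y1 y2 y3]] := h (maxn m0 m1) t' (ltnW tt').
  have cut t2 m2 : t < t2 -> t2 <= t' -> m2 <= maxn m0 m1 ->
      [/\ y %/ 2 ^ (t' - t2) < 2 ^ t2,
      y %/ 2 ^ (t' - t2) %/ 2 ^ (t2 - t.+1) = y %/ 2 ^ (t' - t.+1) &
      P m2 t2 (y %/ 2 ^ (t' - t2))].
    move=> a1 a2 a3; split.
    - by rewrite ltn_divLR ?expn_gt0 // -expnD subnKC.
    - by rewrite -divnMA -expnD; congr (_ %/ 2 ^ _); lia.
    - by apply: trunc => //; apply: anti y3.
  have ye : y %/ 2 ^ (t' - t.+1) = odd (y %/ 2 ^ (t' - t.+1)) + x.*2.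
    rewrite -{1}(odd_double_half (y %/ 2 ^ (t' - t.+1))); congr (_ + _.*2).
    by rewrite -y2 -divn2 -divnMA -expnSr; congr (_ %/ 2 ^ _); lia.
  case: (odd _) ye => ye.
    have [c1 c2 c3] := cut t1 m1 h1 (leq_maxr _ _) (leq_maxr _ _).
    by have := b1 _ c1 (etrans c2 ye); rewrite c3.
  have [c1 c2 c3] := cut t0 m0 h0 (leq_maxl _ _) (leq_maxl _ _).
  by have := b0 _ c1 (etrans c2 ye); rewrite c3.
have [f hf] : exists f : nat * nat -> bool, forall p, ext p.1 p.2 ->
    ext p.1.+1 (f p + p.2.*2).
  have H (p : nat * nat) : exists b : bool, ext p.1 p.2 -> ext p.1.+1 (b + p.2.*2).
    by have [/extS[b hb]|n] := pselect (ext p.1 p.2); [exists b|exists false].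
  by case: (boolp.choice H) => f hf; exists f.
pose z := fix z t := if t is t'.+1 then f (t', z t') + (z t').*2 else 0.
have zE t : ext t (z t) by elim: t => [//|t /(hf (t, _))].
have zdiv k t : z (k + t) %/ 2 ^ k = z t.
  elim: k => [|k ih]; first by rewrite divn1.
  by rewrite addSn expnS divnMA divn2 half_bit_double.
exists (fun c => odd (z c.+1)) => m t; exists (z t).
  by have [_ /(_ m t (leqnn t))[y [_ <-]]] := zE t; rewrite subnn divn1.
by move=> c ct; rewrite /xbit -(zdiv (t - c.+1) c.+1) subnK.
Qed.

Definition unbounded (P : nat -> Prop) := forall n, exists2 c, n <= c & P c.

Lemma pop_mask n P : pop (mask n P) = bsum n (fun i => P i).
Proof.
rewrite (popE (leq_maxl _ n)) (bsum_widen (leq_maxr (mask n P) n)).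
  by apply: eq_bsum => i hi; rewrite bit_mask hi.
by move=> i hi; rewrite bit_mask ltnNge hi.
Qed.

Lemma mask_bit x n : x <= n -> mask n (bit^~ x) = x.
Proof.
move=> xn; apply: bit_inj => c; rewrite bit_mask andb_idl // => /bit_lt.
by move=> h; exact: leq_trans h xn.
Qed.

Lemma leq_sub x y : (forall c, bit c x -> bit c y) -> x <= y.
Proof.
move=> h; rewrite -[X in X <= _](mask_bit (leq_addr y x)) -[X in _ <= X](mask_bit (leq_addl x y)).
by apply: leq_bsum => i _; case: (boolP (bit i x)) => // /h ->.
Qed.

Lemma pop_le x : pop x <= x.
Proof.
rewrite /pop -[X in _ <= X]muln1 -bsum_cst; apply: leq_bsum => i _.
exact: leq_b1.
Qed.

Lemma unbounded_mask P k n : unbounded P ->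
  exists W, pop W = k /\ forall c, bit c W -> n <= c /\ P c.
Proof.
move=> hP; elim: k => [|k [W [pW hW]]].
  by exists 0; split=> [|c]; rewrite ?/pop ?bsum0 // /bit div0n.
have [c hc Pc] := hP (n + W).
have cW : W <= c by exact: leq_trans (leq_addl _ _) hc.
exists (mask c.+1 (fun i => (i == c) || bit i W)); split.
  rewrite pop_mask bsumS eqxx addn1 -pW (popE cW); congr _.+1.
  by apply: eq_bsum => i hi; rewrite (ltn_eqF hi).
move=> i; rewrite bit_mask => /andP[_ /orP[/eqP->|/hW //]].
by split=> //; exact: leq_trans (leq_addr _ _) hc.
Qed.

Lemma eventually_ball n (Q : nat -> nat -> Prop) :
  (forall i, i < n -> exists s, forall s', s <= s' -> Q i s') ->
  exists s, forall s', s <= s' -> forall i, i < n -> Q i s'.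
Proof.
elim: n => [|n ih] h; first by exists 0.
have [|s hs] := ih; first by move=> i hi; apply: h; exact: ltnW.
have [s1 hs1] := h n (ltnSn n).
exists (maxn s s1) => s'; rewrite geq_max => /andP[a b] i.
by rewrite ltnS leq_eqVlt => /predU1P[->|hi]; [exact: hs1|exact: hs].
Qed.

(** The size [2 * m + 2] leads from [m * m.+1] positions to [m.+1 * m.+2]. The condition [D < 2 ^ c]
    puts [c] beyond all elements of [D], and [result] equals 2 when the output is 1. *)
Definition fits (m D B W s : nat) : bool :=
  (pop W == 2 * m + 2) &&
  ball W (fun c => bit c W ==> (D < 2 ^ c) &&
    ball m (fun i => (nfst i == 0) && bit i B ==> (result s (nsnd i) c == 2))).

Definition join (D W : nat) : nat := mask (D + W) (fun c => bit c D || bit c W).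

Definition push (m B : nat) (b : bool) : nat :=
  mask m.+1 (fun i => if i == m then b else bit i B).

(** Intersection of the sets accepted before stage [m], from which the next block is drawn. *)
Definition pool (m B c : nat) : Prop :=
  forall i, i < m -> nfst i = 0 -> bit i B -> exists s, result s (nsnd i) c = 2.

Lemma bit_join c D W : bit c (join D W) = bit c D || bit c W.
Proof.
rewrite bit_mask andb_idl // => /orP[] /bit_lt h; apply: (leq_trans h).
  exact: leq_addr.
exact: leq_addl.
Qed.

Lemma bit_push m B b i : bit i (push m B b) = (i <= m) && (if i == m then b else bit i B).
Proof. exact: bit_mask. Qed.

Lemma pop_join D W : (forall c, bit c W -> D < 2 ^ c) -> pop (join D W) = pop D + pop W.
Proof.
move=> h; rewrite pop_mask (popE (leq_addr W D)) (popE (leq_addl D W)) -bsumD.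
apply: eq_bsum => c _; case: (boolP (bit c W)) => [/h|_]; last by rewrite orbF addn0.
by move=> /bit_small ->.
Qed.

Section Construction.
Variable X : set nat.

(* The index m is [npair 0 e] for the e-th recursive set, [npair 1 e] for the e-th
   test, and [npair 2 n] for the question whether n belongs to X. *)
Definition coded_bit (m B : nat) : bool :=
  if nfst m == 0 then
    `[< unbounded (fun c => pool m B c /\ exists s, result s (nsnd m) c = 2) >]
  else if nfst m == 1 then
    `[< forall t, bsum (2 ^ t) (hit (nsnd m) (level m.+1) t) * 2 ^ level m.+1 <= 2 ^ t >]
  else nsnd m \in X.

Definition stD (T : nat) := nfst T.
Definition stE (T : nat) := nfst (nsnd T).
Definition stB (T : nat) := nsnd (nsnd T).

(** Bit 1 is coded by the rightmost and bit 0 by the leftmost candidate that stays good. The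
    survivor [G] on the other side keeps the two cases apart. *)
Definition leftmost_or_rightmost (m B D E D' E' : nat) (b : bool) :=
  exists2 G, always_good D E D' m B G &
    if b then G < E' /\ forall G', always_good D E D' m B G' -> G' <= E'
    else E' < G /\ forall G', always_good D E D' m B G' -> E' <= G'.

(** The block is the first one found by a search over pairs of block and stage, which a decoder can
    repeat. *)
Definition next (m T T' : nat) : Prop :=
  [/\ exists w, [/\ fits m (stD T) (stB T) (nfst w) (nsnd w),
        forall i, i < w -> ~~ fits m (stD T) (stB T) (nfst i) (nsnd i) &
        stD T' = join (stD T) (nfst w)],
      always_good (stD T) (stE T) (stD T') m (stB T) (stE T'),
      leftmost_or_rightmost m (stB T) (stD T) (stE T) (stD T') (stE T')
        (coded_bit m (stB T)) &
      stB T' = push m (stB T) (coded_bit m (stB T))].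

Definition invariant (m T : nat) : Prop :=
  [/\ pop (stD T) = m * m.+1,
      forall t, stD T <= t ->
        2 ^ t <= volume m (stB T) (stD T) (stE T) t * 2 ^ level m &
      unbounded (pool m (stB T))].

Lemma fits_ex m D B : unbounded (pool m B) -> exists W s, fits m D B W s.
Proof.
move=> hP; have [W [pW hW]] := unbounded_mask (2 * m + 2) D hP.
have [|s hs] := @eventually_ball W (fun c s => bit c W ->
    forall i, i < m -> nfst i = 0 -> bit i B -> result s (nsnd i) c = 2).
  move=> c _; have [bc|] := boolP (bit c W); last by exists 0.
  have [|s hs] := @eventually_ball m (fun i s => nfst i = 0 -> bit i B ->
      result s (nsnd i) c = 2).
    move=> i im; have [i0|] := eqVneq (nfst i) 0; last by move=> /eqP n; exists 0 => s' _ h; case: (n h).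
    have [bi|] := boolP (bit i B); last by exists 0.
    have [_ /(_ i im i0 bi)[s hs]] := hW c bc.
    by exists s => s' ss _ _; exact: result_mono hs.
  by exists s => s' /hs h _; exact: h.
exists W, s; rewrite /fits pW eqxx; apply/ballP => c cW; apply/implyP => bc.
have [Dc _] := hW c bc; apply/andP; split.
  exact: leq_ltn_trans Dc (ltn_expl _ _).
apply/ballP => i im; apply/implyP => /andP[/eqP i0 bi].
by rewrite (hs s (leqnn s) c cW bc i im i0 bi).
Qed.

Lemma fitsP m D B W s : fits m D B W s ->
  [/\ pop W = 2 * m + 2, forall c, bit c W -> D < 2 ^ c &
   forall c i, bit c W -> i < m -> nfst i = 0 -> bit i B -> result s (nsnd i) c = 2].
Proof.
move=> /andP[/eqP pW /ballP h]; split=> // [c bc|c i bc im i0 bi].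
  by have := h c (bit_lt bc); rewrite bc => /andP[].
have := h c (bit_lt bc); rewrite bc => /andP[_ /ballP/(_ i im)].
by rewrite i0 bi => /eqP.
Qed.

Lemma avoidS m B b t x : avoid m.+1 (push m B b) t x =
  avoid m B t x && ((nfst m == 1) && b ==> ~~ hit (nsnd m) (level m.+1) t x).
Proof.
apply/ballP/andP => [h|[/ballP h1 h2] i].
  split; last by have := h m (ltnSn m); rewrite bit_push leqnn eqxx.
  apply/ballP => i im; have := h i (leqW im).
  by rewrite bit_push (ltnW im) (ltn_eqF im).
rewrite ltnS leq_eqVlt => /predU1P[->|im]; first by rewrite bit_push leqnn eqxx.
by rewrite bit_push (ltnW im) (ltn_eqF im); exact: h1.
Qed.

(** A newly accepted test component removes at most half of the volume guaranteed by [good]. *)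
Lemma volume_push m B b D E t :
  ((nfst m == 1) && b ->
    bsum (2 ^ t) (hit (nsnd m) (level m.+1) t) * 2 ^ level m.+1 <= 2 ^ t) ->
  good m B D E t -> 2 ^ t <= volume m.+1 (push m B b) D E t * 2 ^ level m.+1.
Proof.
rewrite /good; have -> : level m.+1 = (level m.+1).-1.+1 by rewrite /level; lia.
set q := (level m.+1).-1; move=> hb g.
have [acc|rej] := boolP ((nfst m == 1) && b); last first.
  suff -> : volume m.+1 (push m B b) D E t = volume m B D E t.
    by rewrite (leq_trans g) // leq_mul2l leq_exp2l // leqnSn orbT.
  by apply: eq_bsum => x _; rewrite /ok avoidS (negbTE rej) andbT.
have := hb acc; set H := bsum _ _.
have vH : volume m B D E t <= volume m.+1 (push m B b) D E t + H.
  rewrite /volume /H -bsumD; apply: leq_bsum => x _.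
  rewrite /ok avoidS acc implyTb.
  by rewrite [level m.+1](_ : _ = q.+1); [case: agree avoid hit => [] [] []|rewrite /q /level; lia].
move: g vH; rewrite !expnS; move: (volume _ _ _ _ _) (volume _ _ _ _ _) => v v'.
by move: (2 ^ q) (2 ^ t) => a c; nia.
Qed.

(** An unbounded pool supplies the block, and [two_always_good] makes the extreme candidates
    distinct. The volume bound is restored by [volume_push]. *)
Lemma next_ex m T : invariant m T -> exists T', next m T T' /\ invariant m.+1 T'.
Proof.
case; rewrite /stD /stE /stB; set D := nfst T; set E := nfst (nsnd T); set B := nsnd (nsnd T).
move=> pD hv hP.
have [w [hw wmin]] : exists w, fits m D B (nfst w) (nsnd w) /\
    forall i, i < w -> ~~ fits m D B (nfst i) (nsnd i).
  have exw : exists w, fits m D B (nfst w) (nsnd w).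
    by have [W [s h]] := fits_ex D hP; exists (npair W s); rewrite !npairK.
  exists (ex_minn exw); case: ex_minnP => w h hmin; split=> // i iw.
  by apply/negP => /hmin; rewrite leqNgt iw.
have [pW Dlt hW] := fitsP hw.
pose D' := join D (nfst w).
have sub c : bit c D -> bit c D' by move=> h; rewrite bit_join h.
have DD' : D <= D' by exact: leq_sub.
have pD' : pop D' = m.+1 * m.+2 by rewrite pop_join // pD pW; lia.
have [G1 [G2 [lt12 g1 g2]]] := two_always_good sub pD pD'
  (fun t h => hv t (leq_trans DD' h)).
pose AG := always_good D E D' m B.
have [Gmin [hmin min]] : exists G, AG G /\ forall G', AG G' -> G <= G'.
  have exA : exists G, `[< AG G >] by exists G1; exact/asboolP.
  exists (ex_minn exA); case: ex_minnP => G /asboolP h hmin; split=> // G' h'.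
  by apply: hmin; exact/asboolP.
have [Gmax [hmax max]] : exists G, AG G /\ forall G', AG G' -> G' <= G.
  have exA : exists G, `[< AG G >] by exists G1; exact/asboolP.
  have ub G : `[< AG G >] -> G <= 2 ^ D' by move=> /asboolP[/andP[/ltnW]].
  exists (ex_maxn exA ub); case: ex_maxnP => G /asboolP h hmax; split=> // G' h'.
  by apply: hmax; exact/asboolP.
have ltmm : Gmin < Gmax by rewrite (leq_ltn_trans (min _ g1)) // (leq_trans lt12) // max.
pose b := coded_bit m B; pose E' := if b then Gmax else Gmin.
have hE' : AG E' by rewrite /E'; case: (b).
exists (npair D' (npair E' (push m B b))); split.
  rewrite /next /stD /stE /stB !npairK -/D -/E -/B; split=> //.
    by exists w; split.
  rewrite /leftmost_or_rightmost -/b; exists (if b then Gmin else Gmax).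
    by case: (b).
  by rewrite /E'; case: (b).
rewrite /invariant /stD /stE /stB !npairK; split=> //.
  move=> t Dt; apply: volume_push; last by case: hE' => _; apply.
  move=> /andP[/eqP n1]; rewrite /b /coded_bit n1 /= => /asboolP h; exact: h.
(* An accepted set leaves the pool unbounded by the definition of [coded_bit]; otherwise the pool
   does not change. *)
have [acc|] := boolP ((nfst m == 0) && b).
  move: acc => /andP[/eqP n0]; rewrite {1}/b /coded_bit n0 /= => /asboolP h n.
  have [c nc [pc rc]] := h n; exists c => // i.
  rewrite ltnS leq_eqVlt => /predU1P[->//|im] i0.
  by rewrite bit_push (ltnW im) (ltn_eqF im); exact: pc.
move=> rej n; have [c nc pc] := hP n; exists c => // i.
rewrite ltnS leq_eqVlt => /predU1P[->|im] i0.
  by rewrite bit_push leqnn eqxx => bb; case/negP: rej; rewrite i0 bb.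
by rewrite bit_push (ltnW im) (ltn_eqF im); exact: pc.
Qed.

Lemma sequence_ex : exists T : nat -> nat,
  (forall m, next m (T m) (T m.+1)) /\ forall m, invariant m (T m).
Proof.
have [F hF] : exists F : nat * nat -> nat, forall p, invariant p.1 p.2 ->
    next p.1 p.2 (F p) /\ invariant p.1.+1 (F p).
  have H (p : nat * nat) : exists T', invariant p.1 p.2 ->
      next p.1 p.2 T' /\ invariant p.1.+1 T'.
    have [/next_ex[T' h]|n] := pselect (invariant p.1 p.2); first by exists T'.
    by exists 0 => /n.
  by case: (boolp.choice H) => F hF; exists F.
pose T := fix T m := if m is m'.+1 then F (m', T m') else npair 0 (npair 0 0).
have inv m : invariant m (T m).
  elim: m => [|m /(hF (m, _))[_ //]].
  rewrite /invariant /stD /stE /stB !npairK; split.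
  - by rewrite /pop bsum0.
  - move=> t _; rewrite expn0 muln1 -{1}[2 ^ t]muln1 -bsum_cst; apply: leq_bsum => x _.
    rewrite /ok; have -> : avoid 0 0 t x by apply/ballP.
    by rewrite andbT lt0b; apply/ballP => c _; rewrite /bit div0n.
  - by move=> n; exists n => // i.
by exists T; split=> // m; have [] := hF (m, T m) (inv m).
Qed.

End Construction.

Ltac rec_ext ::= match goal with
  | |- rec_in _ (fun x => result _ _ _) => refine (rec_result _ _ _)
  | |- rec_in _ (fun x => nat_of_bool (bit _ _)) => refine (rec_bit _ _)
  | H : rec_in ?A ?f |- rec_in ?A (fun x => ?f (@?g x)) => refine (@rec_comp A f g H _)
  | H : rec_in ?A (fun x => nat_of_bool (?f x)) |- rec_in ?A (fun x => nat_of_bool (?f (@?g x))) =>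
      refine (@rec_comp A (fun x => nat_of_bool (f x)) g H _)
  | |- rec_in ?A _ => assumption
  end.

(** * Recursiveness of the ingredients of a stage *)

Section RecConstruction.
Variable A : set nat.
Variables m B D E D' G W s t : nat -> nat.
Hypotheses (rm : rec_in A m) (rB : rec_in A B) (rD : rec_in A D) (rE : rec_in A E).
Hypotheses (rD' : rec_in A D') (rG : rec_in A G) (rW : rec_in A W) (rs : rec_in A s).
Hypothesis (rt : rec_in A t).

Lemma rec_fits : rec_in A (fun z => fits (m z) (D z) (B z) (W z) (s z)).
Proof. by rewrite /fits /pop; rec_tac. Qed.

Lemma rec_join : rec_in A (fun z => join (D z) (W z)).
Proof. by rewrite /join /mask; rec_tac. Qed.

Lemma rec_cand : rec_in A (fun z => cand (D z) (E z) (D' z) (G z)).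
Proof. by rewrite /cand; rec_tac. Qed.

Lemma rec_good : rec_in A (fun z => good (m z) (B z) (D z) (E z) (t z)).
Proof.
rewrite /good /volume /ok /agree /avoid /hit /xbit /pcode /xbit /level.
by rec_tac.
Qed.

Lemma rec_push (b : nat -> bool) : rec_in A b ->
  rec_in A (fun z => push (m z) (B z) (b z)).
Proof. by move=> rb; rewrite /push /mask; rec_tac. Qed.

End RecConstruction.

(** * Decoding *)

Section Sequence.
Variables (X : set nat) (T : nat -> nat).
Hypotheses (nextT : forall m, next X m (T m) (T m.+1)) (invT : forall m, invariant m (T m)).

Local Notation D m := (stD (T m)).
Local Notation E m := (stE (T m)).
Local Notation B m := (stB (T m)).

Lemma bit_DS m c : bit c (D m) -> bit c (D m.+1).
Proof. by case: (nextT m) => -[w [_ _ ->]] _ _ _; rewrite bit_join => ->. Qed.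

Lemma bit_D m m' c : m <= m' -> bit c (D m) -> bit c (D m').
Proof.
move=> /subnKC <-; elim: (m' - m) => [|k ih]; first by rewrite addn0.
by rewrite addnS => /ih; exact: bit_DS.
Qed.

Lemma bit_E m m' c : m <= m' -> bit c (D m) -> bit c (E m') = bit c (E m).
Proof.
move=> /subnKC <- h; elim: (m' - m) => [|k ih]; first by rewrite addn0.
rewrite addnS -ih; case: (nextT (m + k)) => _ [/candP]; case/(_ (@bit_DS _)) => _ _ e _ _ _.
by apply: e; apply: bit_D h; exact: leq_addr.
Qed.

Lemma bit_B m m' i : i < m -> m <= m' -> bit i (B m') = bit i (B m).
Proof.
move=> im /subnKC <-; elim: (m' - m) => [|k ih]; first by rewrite addn0.
have ik : i < m + k by exact: leq_trans im (leq_addr _ _).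
rewrite addnS -ih; case: (nextT (m + k)) => _ _ _ ->.
by rewrite bit_push (ltnW ik) (ltn_eqF ik).
Qed.

Lemma bit_coded m m' : m < m' -> bit m (B m') = coded_bit X m (B m).
Proof.
move=> mm; rewrite (bit_B (ltnSn m) mm); case: (nextT m) => _ _ _ ->.
by rewrite bit_push leqnn eqxx.
Qed.

Lemma limit_ex : exists Z : nat -> bool,
  forall m t, exists2 x, ok m (B m) (D m) (E m) t x & forall c, c < t -> xbit t x c = Z c.
Proof.
apply: (konig (P := fun m t x => ok m (B m) (D m) (E m) t x)).
- by move=> *; exact: ok_trunc.
- move=> m m' t y mm /andP[/ballP h1 /ballP h2]; apply/andP; split; apply/ballP.
    move=> c ct; apply/implyP => hc; rewrite -(bit_E mm hc).
    by have := h1 c ct; rewrite (bit_D mm hc).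
  by move=> i im; rewrite -(bit_B im mm); apply: h2; exact: leq_trans mm.
(* The volume bound holds for lengths at least [D m], so a longer string is found first and then
   truncated. *)
- move=> m t; pose t' := maxn t (D m).
  have [_ /(_ t' (leq_maxr _ _)) hv _] := invT m.
  have [/existsP[/= x hx]|/existsPn no] :=
    boolP [exists x : 'I_(2 ^ t'), ok m (B m) (D m) (E m) t' x].
    have tt' : t <= t' by exact: leq_maxl.
    exists (x %/ 2 ^ (t' - t)); last exact: ok_trunc.
    by rewrite ltn_divLR ?expn_gt0 // -expnD subnKC.
  move: hv; rewrite /volume /bsum big1 ?mul0n ?leqn0 ?expn_eq0 // => x _.
  by rewrite (negbTE (no x)).
Qed.

(** * Recovery of the construction from a set that agrees with [Z] on late blocks *)

Section Decoder.
Variable Z : nat -> bool.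
Hypothesis hZ : forall m t, exists2 x, ok m (B m) (D m) (E m) t x &
  forall c, c < t -> xbit t x c = Z c.

Lemma limitE m c : bit c (D m) -> bit c (E m) = Z c.
Proof.
move=> hc; have [x /andP[/ballP/(_ c (ltnSn c)) h _] <- //] := hZ m c.+1.
by move: h; rewrite hc => /eqP.
Qed.

Variables (Q : set nat) (m0 : nat).
Hypothesis hQ : forall m c, m0 <= m -> bit c (D m.+1) -> ~~ bit c (D m) -> (c \in Q) = Z c.

(** The oracle decides only positions of the new block; on [D] the known [E] is used, since [Q] may
    differ from [Z] there. *)
Let read (D E W : nat) : nat :=
  mask (join D W) (fun c => if bit c D then bit c E else bit c W && (c \in Q)).

Let none_left (m B D E W t : nat) : bool :=
  ball (read D E W) (fun G => cand D E (join D W) G ==> ~~ good m B (join D W) G t).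

Let none_right (m B D E W t : nat) : bool :=
  ball (2 ^ join D W) (fun G => (read D E W < G) && cand D E (join D W) G ==>
    ~~ good m B (join D W) G t).

(** The guard on [t] matches [always_good], which speaks of stages from [D'] on. *)
Let decided (m B D E W t : nat) : bool :=
  (join D W <= t) && (none_left m B D E W t || none_right m B D E W t).

Lemma readE m w : m0 <= m -> D m.+1 = join (D m) w -> read (D m) (E m) w = E m.+1.
Proof.
move=> mm e; case: (nextT m) => _ [/candP] /(_ (@bit_DS m))[c1 c2 c3] _ _ _.
apply: bit_inj => c; rewrite bit_mask -e.
have [cD|] := boolP (bit c (D m)); first by rewrite c3 // bit_lt // bit_DS.
move=> nD; have [cD'|nD'] := boolP (bit c (D m.+1)).
  rewrite (hQ mm cD' nD) limitE // bit_lt //=.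
  by move: cD'; rewrite e bit_join (negbTE nD) => /= ->.
rewrite (negbTE (contra (c2 c) nD')).
by move: nD'; rewrite e bit_join negb_or => /andP[_ /negbTE->]; rewrite andbF.
Qed.

(** On the side where no candidate survives, finitely many failures are seen by some stage; on the
    other side a survivor prevents the same observation. *)
Lemma decidedP m w : m0 <= m -> D m.+1 = join (D m) w ->
  (exists t, decided m (B m) (D m) (E m) w t) /\
  forall t, decided m (B m) (D m) (E m) w t ->
    none_left m (B m) (D m) (E m) w t = ~~ coded_bit X m (B m).
Proof.
move=> mm e; have := nextT m; case=> _ _; rewrite /leftmost_or_rightmost.
case: (coded_bit _ _ _) => -[G [cG gG] [lt ext]] _.
all: rewrite /decided /none_left /none_right (readE mm e) -e; split.
- have [|s hs] := @eventually_ball (2 ^ D m.+1) (fun G s => (E m.+1 < G) &&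
      cand (D m) (E m) (D m.+1) G -> ~~ good m (B m) (D m.+1) G s).
    move=> G' _; have [/andP[lt' c']|_] := boolP (_ && _); last by exists 0.
    have [t [Dt ng]] : exists t, D m.+1 <= t /\ ~~ good m (B m) (D m.+1) G' t.
      apply: contrapT => no; have := ext G'; rewrite leqNgt lt' => H.
      suff : false by []. apply: H; split=> // t Dt; apply/negPn/negP => ng.
      by apply: no; exists t.
    by exists t => s ts _; apply: contra ng; exact: good_mono.
  exists (maxn s (D m.+1)); rewrite leq_maxr; apply/orP; right; apply/ballP => G' GD.
  by apply/implyP => /(hs _ (leq_maxl _ _) _ GD).
(* The survivor to the left refutes [none_left] at every stage. *)
- move=> t /andP[Dt _]; apply/ballP => /(_ G lt).
  by rewrite cG gG.
- have [|s hs] := @eventually_ball (E m.+1) (fun G s =>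
      cand (D m) (E m) (D m.+1) G -> ~~ good m (B m) (D m.+1) G s).
    move=> G' lt'; have [c'|_] := boolP (cand _ _ _ _); last by exists 0.
    have [t [Dt ng]] : exists t, D m.+1 <= t /\ ~~ good m (B m) (D m.+1) G' t.
      apply: contrapT => no; have := ext G'; rewrite leqNgt lt' => H.
      suff : false by []. apply: H; split=> // t Dt; apply/negPn/negP => ng.
      by apply: no; exists t.
    by exists t => s ts _; apply: contra ng; exact: good_mono.
  exists (maxn s (D m.+1)); rewrite leq_maxr; apply/orP; left; apply/ballP => G' GD.
  by apply/implyP => /(hs _ (leq_maxl _ _) _ GD).
(* The survivor to the right excludes [none_right], so [none_left] was observed. *)
- move=> t /andP[Dt /orP[//|/ballP h]].
  have GD : G < 2 ^ D m.+1 by case/andP: cG.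
  by have := h G GD; rewrite lt cG gG.
Qed.

Lemma rec_read d e w : rec_in Q d -> rec_in Q e -> rec_in Q w ->
  rec_in Q (fun z => read (d z) (e z) (w z)).
Proof.
move=> rd re rw; rewrite /read /mask.
have rj := rec_join rd rw.
by rec_tac.
Qed.

Lemma rec_none_left m b d e w t : rec_in Q m -> rec_in Q b -> rec_in Q d -> rec_in Q e ->
  rec_in Q w -> rec_in Q t ->
  rec_in Q (fun z => none_left (m z) (b z) (d z) (e z) (w z) (t z)).
Proof.
move=> rm rb rd re rw rt; rewrite /none_left.
have rj := rec_join rd rw; have rr := rec_read rd re rw.
apply: (@rec_forall Q (fun z => read (d z) (e z) (w z)) (fun z G =>
  cand (d z) (e z) (join (d z) (w z)) G ==> ~~ good (m z) (b z) (join (d z) (w z)) G (t z))) => //.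
apply: rec_imply; first by apply: rec_cand; rec_tac; apply: (rec_comp rj); rec_tac.
by apply: rec_neg; apply: rec_good; rec_tac; apply: (rec_comp rj); rec_tac.
Qed.

Lemma rec_none_right m b d e w t : rec_in Q m -> rec_in Q b -> rec_in Q d -> rec_in Q e ->
  rec_in Q w -> rec_in Q t ->
  rec_in Q (fun z => none_right (m z) (b z) (d z) (e z) (w z) (t z)).
Proof.
move=> rm rb rd re rw rt; rewrite /none_right.
have rj := rec_join rd rw; have rr := rec_read rd re rw.
apply: (@rec_forall Q (fun z => 2 ^ join (d z) (w z)) (fun z G =>
  (read (d z) (e z) (w z) < G) && cand (d z) (e z) (join (d z) (w z)) G ==>
  ~~ good (m z) (b z) (join (d z) (w z)) G (t z))); first exact: rec_exp2.
apply: rec_imply; first apply: rec_and.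
- by apply: rec_le; last rec_tac; apply: rec_S; apply: (rec_comp rr); rec_tac.
- by apply: rec_cand; rec_tac; apply: (rec_comp rj); rec_tac.
- by apply: rec_neg; apply: rec_good; rec_tac; apply: (rec_comp rj); rec_tac.
Qed.

(** The finite history [T m0] is built into the program; each later stage is found by a search for
    the block followed by a search for a deciding stage. *)
Lemma rec_sequence : rec_in Q (fun k => T (m0 + k)).
Proof.
have hw k : exists w, [/\ fits (m0 + k) (D (m0 + k)) (B (m0 + k)) (nfst w) (nsnd w),
    forall i, i < w -> ~~ fits (m0 + k) (D (m0 + k)) (B (m0 + k)) (nfst i) (nsnd i) &
    D (m0 + k).+1 = join (D (m0 + k)) (nfst w)].
  by case: (nextT (m0 + k)).
have [w {}hw] := boolp.choice hw.
have ht k : exists t, decided (m0 + k) (B (m0 + k)) (D (m0 + k)) (E (m0 + k)) (nfst (w k)) t /\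
    forall i, i < t -> ~~ decided (m0 + k) (B (m0 + k)) (D (m0 + k)) (E (m0 + k)) (nfst (w k)) i.
  have [_ _ e] := hw k; have [ex _] := decidedP (leq_addr k m0) e.
  exists (ex_minn ex); case: ex_minnP => t h hmin; split=> // i it.
  by apply/negP => /hmin; rewrite leqNgt it.
have [t {}ht] := boolp.choice ht.
pose s1 z := nfst z; pose s2 z := nfst (nfst z).
pose c1 z := fits (m0 + nfst (s1 z)) (stD (nsnd (s1 z))) (stB (nsnd (s1 z)))
  (nfst (nsnd z)) (nsnd (nsnd z)).
pose mz z := m0 + nfst (s2 z); pose Tz z := nsnd (s2 z); pose Wz z := nfst (nsnd (nfst z)).
pose c2 z := decided (mz z) (stB (Tz z)) (stD (Tz z)) (stE (Tz z)) (Wz z) (nsnd z).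
pose h z := npair (join (stD (Tz z)) (Wz z)) (npair (read (stD (Tz z)) (stE (Tz z)) (Wz z))
  (push (mz z) (stB (Tz z))
    (~~ none_left (mz z) (stB (Tz z)) (stD (Tz z)) (stE (Tz z)) (Wz z) (nsnd z)))).
have rm : rec_in Q mz by rewrite /mz /s2; rec_tac.
have rB : rec_in Q (fun z => stB (Tz z)) by rewrite /stB /Tz /s2; rec_tac.
have rD : rec_in Q (fun z => stD (Tz z)) by rewrite /stD /Tz /s2; rec_tac.
have rE : rec_in Q (fun z => stE (Tz z)) by rewrite /stE /Tz /s2; rec_tac.
have rW : rec_in Q Wz by rewrite /Wz; rec_tac.
have rt : rec_in Q nsnd by exact: rec_snd.
have rN := rec_none_left rm rB rD rE rW rt.
apply: (@rec_iter_search Q (fun k => T (m0 + k)) w t c1 c2 h).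
- by apply: rec_fits; rewrite /stD /stB /s1; rec_tac.
- apply: rec_and; first by apply: rec_le => //; exact: rec_join.
  by apply: rec_or => //; exact: rec_none_right.
- by apply: rec_pair; [exact: rec_join|apply: rec_pair; [exact: rec_read|
    apply: rec_push => //; exact: rec_neg]].
- move=> k; rewrite /c1 /s1 !npairK; have [h1 h2 _] := hw k.
  by split=> // i; rewrite !npairK; exact: h2.
- move=> k; rewrite /c2 /mz /Tz /Wz /s2 !npairK; have [h1 h2] := ht k.
  by split=> // i; rewrite !npairK; exact: h2.
- move=> k; rewrite /h /mz /Tz /Wz /s2 !npairK.
  have [_ _ e] := hw k; have [h1 _] := ht k; have mm := leq_addr k m0.
  have [_ /(_ _ h1) ->] := decidedP mm e.
  rewrite negbK (readE mm e) -e addnS; case: (nextT (m0 + k)) => _ _ _ <-.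
  by rewrite !npairE.
Qed.

(** Membership of [n] in [X] is the bit with index [npair 2 n], which any later state of the
    sequence records. *)
Lemma decode : turing_le X Q.
Proof.
have r : rec_in Q (fun n => bit (npair 2 n) (stB (T (m0 + (npair 2 n).+1)))).
  have rn : rec_in Q (fun n => npair 2 n) by rec_tac.
  have rT := rec_comp rec_sequence (rec_S rn).
  by apply: rec_bit => //; rewrite /stB; do 2!apply: rec_snd1.
have [p hp] := r; exists p => n; have := hp n.
rewrite bit_coded; last by rewrite addnS ltnS leq_addl.
by rewrite /coded_bit !npairK.
Qed.

End Decoder.
End Sequence.

(** * Uniform measure of open sets *)

Section Measure.
Variable K : realType.

Definition dyadic (t x : nat) : set K :=
  `[(x%:R / (2 ^ t)%:R)%R, (x.+1%:R / (2 ^ t)%:R)%R[%classic.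

Lemma dyadicP t x (z : K) : dyadic t x z <-> (x%:R <= z * (2 ^ t)%:R < x.+1%:R)%R.
Proof.
have t0 : (0 < (2 ^ t)%:R :> K)%R by rewrite ltr0n expn_gt0.
by rewrite /dyadic /= in_itv /= ler_pdivrMr // ltr_pdivlMr.
Qed.

Lemma dyadic_expansion t x (z : K) c : dyadic t x z -> c < t ->
  (c \in binary_expansion z) = xbit t x c.
Proof.
move=> /dyadicP/andP[h1 h2] ct.
have e : (2 ^ t = 2 ^ (t - c.+1) * 2 ^ c.+1)%N by rewrite -expnD subnK.
have p0 : (0 < (2 ^ (t - c.+1))%:R :> K)%R by rewrite ltr0n expn_gt0.
have tr : Num.truncn (z * 2 ^+ c.+1)%R = x %/ 2 ^ (t - c.+1).
  apply: truncn_def; rewrite -natrX; apply/andP; split.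
    rewrite -(ler_pM2r p0) -mulrA -!natrM [X in (_ * X%:R)%R]mulnC -e.
    by apply: le_trans h1; rewrite ler_nat leq_trunc_div.
  rewrite -(ltr_pM2r p0) -mulrA -!natrM [X in (_ * X%:R)%R]mulnC -e.
  apply: lt_le_trans h2 _; rewrite ler_nat.
  by rewrite ltn_ceil // expn_gt0.
rewrite /xbit -tr.
by apply/idP/idP => [/set_mem|h]; [|exact: mem_set].
Qed.

Lemma dyadic_disjoint t x y (z : K) : dyadic t x z -> dyadic t y z -> x = y.
Proof.
move=> /dyadicP/andP[a1 a2] /dyadicP/andP[b1 b2].
have := le_lt_trans a1 b2; have := le_lt_trans b1 a2; rewrite !ltr_nat !ltnS => h1 h2.
by apply/eqP; rewrite eqn_leq h1 h2.
Qed.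

Lemma measure_dyadic t x : lebesgue_measure (dyadic t x) = ((2 ^ t)%:R^-1 : K)%:E.
Proof.
have t0 : (0 < (2 ^ t)%:R :> K)%R by rewrite ltr0n expn_gt0.
rewrite /dyadic lebesgue_measure_itv /= lte_fin ltr_pM2r ?invr_gt0 // ltr_nat ltnSn.
by rewrite -EFinB -mulrBl -natrB // subSnn mul1r.
Qed.

(** The dyadic intervals of the strings in [P] are disjoint and lie in the preimage of the open set,
    so their total length is at most [2 ^- n]. *)
Lemma count_prefixes (W : set bitseq) n t (P : nat -> bool) :
  (uniform_measure K (open_of W) <= (2 ^- n)%R%:E)%E ->
  (forall x, P x -> exists2 k, k <= t & W (mkseq (xbit t x) k)) ->
  bsum (2 ^ t) P * 2 ^ n <= 2 ^ t.
Proof.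
move=> hW hP.
pose A := \big[setU/set0]_(x < 2 ^ t | P x) dyadic t x.
have mA : lebesgue_measure A = ((bsum (2 ^ t) P)%:R / (2 ^ t)%:R : K)%R%:E.
  rewrite /A measure_bigsetU_ord.
  - rewrite (eq_bigr (fun=> ((2 ^ t)%:R^-1 : K)%:E)) => [|x _]; last exact: measure_dyadic.
    rewrite sumEFin; congr EFin; rewrite big_mkcond /= /bsum natr_sum mulr_suml.
    by apply: eq_bigr => x _; case: (P x); rewrite ?mul1r ?mul0r.
  - by move=> x; exact: measurable_itv.
  - by move=> x y _ _ [z [hx hy]]; apply/val_inj/(dyadic_disjoint hx hy).
have sub : A `<=` `[0%R, 1%R[ `&` @binary_expansion K @^-1` open_of W.
  rewrite /A; elim/big_ind: _ => [|S1 S2 s1 s2|x Px z hz]; first exact: sub0set.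
    by rewrite subUset.
  split.
    move/dyadicP: (hz) => /andP[h1 h2].
    have t0 : (0 < (2 ^ t)%:R :> K)%R by rewrite ltr0n expn_gt0.
    rewrite /= in_itv /= -(pmulr_lge0 _ t0) (le_trans _ h1) ?ler0n //=.
    by rewrite -(ltr_pM2r t0) mul1r (lt_le_trans h2) // ler_nat.
  have [k kt Wk] := hP _ Px; exists k.
  suff -> : initial_segment (binary_expansion z) k = mkseq (xbit t x) k by [].
  apply/eq_in_map => c; rewrite mem_iota => /andP[_ ck].
  by apply: dyadic_expansion hz _; exact: leq_trans kt.
(* Unfolded to an outer measure, [lebesgue_measure] is monotone on arbitrary sets. *)
have mono : (lebesgue_measure A <= uniform_measure K (open_of W))%E.
  rewrite /uniform_measure /lebesgue_measure /lebesgue_stieltjes_measure /measure_extension.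
  by apply: le_mu_ext; exact: sub.
have := le_trans mono hW; rewrite mA lee_fin.
rewrite ler_pdivrMr ?ltr0n ?expn_gt0 // mulrC ler_pdivlMr ?exprn_gt0 //.
by rewrite -natrX -natrM ler_nat.
Qed.
End Measure.

(** * Randomness and splitting *)

Section Splitting.
Variables (X : set nat) (T : nat -> nat) (Z : set nat).
Hypotheses (nextT : forall m, next X m (T m) (T m.+1)) (invT : forall m, invariant m (T m)).

Local Notation D m := (stD (T m)).
Local Notation E m := (stE (T m)).
Local Notation B m := (stB (T m)).

Hypothesis hZ : forall m t, exists2 x, ok m (B m) (D m) (E m) t x &
  forall c, c < t -> xbit t x c = (c \in Z).

(** A genuine test passes the volume check at its own index [m], so its bit is 1 and [Z] avoids the
    component [level m.+1]. *)
Lemma limit_random (K : realType) : martin_lof_random K Z.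
Proof.
move=> V [[p hp] hV] hits.
pose m := npair 1 (prog_code p); pose n := level m.+1.
have acc : bit m (B m.+1).
  rewrite (bit_coded nextT (ltnSn m)) /coded_bit /m !npairK /=.
  apply/asboolP => t; apply: (count_prefixes (hV n)) => x /bexP[k].
  rewrite ltnS => kt; rewrite -string_code_mkseq => /result_sound h.
  by exists k => //; apply/hp.
have [k Vk] := hits n I.
have [y hy] := (hp _ _).1 Vk.
have [s hs] := result_complete hy.
(* The length covers both the prefix of length [k] and the stage [s] at which it is enumerated. *)
have [x /andP[_ /ballP/(_ m (ltnSn m))]] := hZ m.+1 (maxn k s).
rewrite acc /m !npairK /= => /negP no xZ; apply: no; apply/bexP; exists k.
  by rewrite ltnS leq_maxl.
rewrite -string_code_mkseq.
have -> : mkseq (xbit (maxn k s) x) k = initial_segment Z k.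
  apply/eq_in_map => c; rewrite mem_iota => /andP[_ ck].
  by apply: xZ; apply: leq_trans ck (leq_maxl _ _).
by rewrite (result_mono (leq_maxr _ _) hs).
Qed.

(** The blocks move to infinity because [m <= pop D <= D < 2 ^ c]. *)
Lemma new_position m c : bit c (D m.+1) -> ~~ bit c (D m) -> m < 2 ^ c /\ pool m (B m) c.
Proof.
move=> cD nD; case: (nextT m) => -[w [/fitsP[_ lt hW] _ e]] _ _ _.
have cW : bit c (nfst w) by move: cD; rewrite e bit_join (negbTE nD).
split; last by move=> i im i0 bi; exists (nsnd w); exact: hW.
apply: leq_ltn_trans (lt c cW); case: (invT m) => pD _ _.
by apply: leq_trans (pop_le _); rewrite pD leq_pmulr.
Qed.

(** If [R] was accepted, all later blocks lie inside [R]. If it was rejected, the pool meets [R] in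
    a bounded set, and blocks far enough out avoid [R]. *)
Lemma split_turing R : recursive R ->
  turing_le X (Z `&` R) \/ turing_le X (Z `\` R).
Proof.
move=> [p hp]; pose m := npair 0 (prog_code p).
have inR c : (exists s, result s (prog_code p) c = 2) <-> c \in R.
  have [t ht] := result_complete (hp c); split=> [[s hs]|h]; last by exists t; rewrite ht h.
  by have := result_inj hs ht; case: (c \in R).
have [acc|rej] := boolP (coded_bit X m (B m)); [left|right].
- apply: (decode nextT (Z := fun c => c \in Z) hZ (m0 := m.+1)) => m' c mm cD nD.
  have [_ hc] := new_position cD nD.
  suff cR : c \in R by rewrite in_setI cR andbT.
  apply/inR; have := hc m mm; rewrite /m !npairK; apply=> //.
  by rewrite (bit_coded nextT mm).
- have [n hn] : exists n, forall c, n <= c -> pool m (B m) c -> c \notin R.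
    apply: contrapT => no; case/negP: rej; rewrite /coded_bit /m !npairK /=.
    apply/asboolP => n; apply: contrapT => H; apply: no; exists n => c nc pc.
    apply/negP => /inR cR; apply: H; exists c => //.
  (* From stage [2 ^ n] on, [new_position] gives [2 ^ n < 2 ^ c], which puts new positions beyond
     [n]. *)
  apply: (decode nextT (Z := fun c => c \in Z) hZ (m0 := maxn m (2 ^ n))) => m' c.
  rewrite geq_max => /andP[mm nm] cD nD.
  have [m'c hc] := new_position cD nD.
  suff cR : c \notin R by rewrite in_setD cR andbT.
  apply: hn => [|i im i0 bi].
    by apply: ltnW; rewrite -(ltn_exp2l (m := 2)) // (leq_ltn_trans nm).
  by apply: hc => //; [exact: leq_trans mm|rewrite (bit_B nextT im mm)].
Qed.

End Splitting.

Theorem mainTheorem11 (K : realType) (U : prog)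
    (HU : universal_prefix_free_machine U) :
  exists Z : set nat,
    martin_lof_random K Z /\
    forall R : set nat, recursive R ->
      turing_le (Omega K U) (Z `&` R) \/ turing_le (Omega K U) (Z `\` R).
Proof.
have [T [nextT invT]] := sequence_ex (Omega K U).
have [z hz] := limit_ex nextT invT.
have hZ m t : exists2 x, ok m (stB (T m)) (stD (T m)) (stE (T m)) t x &
    forall c, c < t -> xbit t x c = (c \in [set c | z c]).
  have [x okx xz] := hz m t; exists x => // c ct.
  by rewrite xz //; apply/idP/idP => [|/set_mem //]; exact: mem_set.
exists [set c | z c]; split; first exact: (limit_random nextT hZ).
by move=> R; exact: (split_turing nextT invT hZ).
Qed.
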